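(* Let $m\ge4$ be even. Suppose given an admissible marked factorization $(S_c)_{1\le c\le d}$ of $T_m(a_1,\ldots,a_n)$, with distinguished colour set $\mathcal A$, marked set $U$ and vertex identification $X=Y\times\mathbb Z_m$. Then for any direction $i$ of multiplicity $a=a_i\ge2$ there is a binary coordinate split of direction $i$ into children of multiplicities $\lceil a/2\rceil$ and $\lfloor a/2\rfloor$ such that the resulting factorization, with the same distinguished colour set $\mathcal A$, marked set $U\times\{0\}\subseteq X\times\mathbb Z_m$ and identification of its vertex set with $X\times\mathbb Z_m$, is again an admissible marked factorization, and every valid distinguished recolouring supported on $U$ transports to a valid recolouring supported on $U\times\{0\}$ with the same number of cycles in each colour. If the multiplicity sum is $d=\sum_i a_i$ and there are $n$ coordinates, then exactly $d-n$ successive such splits yield the multiplicities $(1,\ldots,1)$. If a valid recolouring of the initial factorization makes every colour a single (Hamilton) cycle, then its transport makes every colour a single cycle after these splits.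
   Context: **Multitori and factorizations.** For positive integers $a_1,\dots,a_n$ with $d=\sum_i a_i$, $T_m(a_1,\dots,a_n)$ is the directed multigraph on $X=\mathbb Z_m^n$ having $a_i$ separately labelled arcs from $x$ to $x+e_i$ at each vertex. A permutation factorization is a list of permutations $S_1,\dots,S_d$ of $\mathbb Z_m^n$ (one per colour) and direction functions $\partial_c:\mathbb Z_m^n\to\{1,\dots,n\}$ with $S_c(x)=x+e_{\partial_c(x)}$ and $|\{c:\partial_c(x)=i\}|=a_i$ for all $x,i$. A colour–cycle label is a pair $(c,C)$ with $C$ a cycle of $S_c$; $\Omega$ denotes the set of all colour–cycle labels. A subset (block) of vertices is cycle-consistent if every direction function $\partial_c$ is constant on it and, for every colour $c$, it lies in a single cycle of $S_c$. **Binary coordinate split.** For a direction $i$ and $0<b<a_i$, choose $\delta_c(x)\in\{0,1\}$ with $\delta_c(x)=0$ if $\partial_c(x)\ne i$ and $\sum_c\delta_c(x)=b$ for each $x$. The split has the same colours, with $\widehat S_c(x,t)=(S_cx,t+\delta_c(x))$ on $X\times\mathbb Z_m$; via $(x,t)\mapsto(x_1,\dots,x_{i-1},x_i-t,t,x_{i+1},\dots,x_n)$ it is a permutation factorization of $T_m(a_1,\dots,a_{i-1},a_i-b,b,a_{i+1},\dots,a_n)$. Here $b=\lfloor a/2\rfloor$. After the split, the new identification of the vertex set is $X\times\mathbb Z_m$, i.e. the new fibres are $\{x\}\times\mathbb Z_m$ over old vertices $x$ and the last fibre coordinate is $t$. **Gaps.** For a permutation $S$ and marked set $U$, on each cycle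 meeting $U$ the open $U$-gaps are the sets of vertices strictly between consecutive marked vertices on the cycle (if the cycle contains a single marked vertex, its complement in the cycle is the only open gap). **Recolourings.** For a set $\mathcal A$ of distinguished colours, a valid recolouring supported on $U$ consists of permutations $S'_c$ such that for each $x\in U$ there is $\sigma_x\in\mathrm{Sym}(\mathcal A)$ with $S'_c(x)=S_{\sigma_x(c)}(x)$ for $c\in\mathcal A$, while $S'_c(x)=S_c(x)$ for $x\notin U$ or $c\notin\mathcal A$; validity includes that all $S'_c$ are bijective. Its transport to a split is defined by using $\sigma_x$ at $(x,0)$ for $x\in U$ (applied to the factors $\widehat S_c$) and leaving all other sources unchanged. **Admissible marked factorization.** It consists of a permutation factorization of $T_m(a_1,\dots,a_n)$ with vertex set $X$, a set $\mathcal A$ of distinguished colours, a marked set $U\subseteq X$, and an identification (bijection) $X=Y\times\mathbb Z_m$ such that: (i) each fibre $\{y\}\times\mathbb Z_m$ is cycle-consistent; (ii) at each vertex, each coordinate direction is used by at most one distinguished colour; (iii) $U\subseteq Y\times\{0\}$, and in every cycle of a distinguished colour that meets $U$, all vertices with nonzero last fibre coordinate lie in one open $U$-gap; (iv) for every direction $i$ with $a_i\ge2$, every connected component of the block–cycle incidence graph contains an even number of cycle-column vertices. Here the block–cycle incidence graph of direction $i$ is bipartite with one vertex for each fibre $B=\{y\}\times\mathbb Z_m$ and one column vertex for each label $(c,C)\in\Omega$ (all labels included), with $B$ and $(c,C)$ adjacent when $B\subseteq C$ and colour $c$ uses direction $i$ on $B$. *)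

(* Defs.v *)
From HB Require Import structures.
From mathcomp Require Import all_boot all_order all_fingroup all_algebra.

Set Implicit Arguments.
Unset Strict Implicit.
Unset Printing Implicit Defensive.

Import GRing.Theory.
Local Open Scope ring_scope.

(* The vertex set Z_m^n; 'Z_m is the integers mod m only for 1 < m. *)
Definition torus (m n : nat) := {ffun 'I_n -> 'Z_m}.

Definition unit_vec (m n : nat) (i : 'I_n) : torus m n := [ffun j => (j == i)%:R].

(* Unconstrained data of a marked factorization with d colours; the
   requirements on it are the predicates [factorization] and [admissible]. *)
Record marked (m d : nat) := Marked {
  ncoord : nat;
  multiplicity : 'I_ncoord -> nat;
  fact : 'I_d -> {perm (torus m ncoord)};
  dir : 'I_d -> torus m ncoord -> 'I_ncoord;
  distinguished : {set 'I_d};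
  mark : {set (torus m ncoord)};
  base : finType;
  ident : torus m ncoord -> base * 'Z_m }.

Arguments multiplicity {m d} _ _.
Arguments fact {m d} _ _.
Arguments dir {m d} _ _ _.
Arguments ident {m d} _ _.

Notation vertex F := (torus _ (ncoord F)).

Record factorization (m d : nat) (F : marked m d) : Prop := Factorization {
  mult_gt0 : forall i, (0 < multiplicity F i)%N;
  sum_mult : d = (\sum_i multiplicity F i)%N;
  fact_step : forall c x, fact F c x = x + unit_vec m (dir F c x);
  card_dir : forall (x : vertex F) i, #|[set c | dir F c x == i]| = multiplicity F i }.

Definition fibre (m d : nat) (F : marked m d) (y : base F) : {set vertex F} :=
  [set x | (ident F x).1 == y].

Definition cycle_consistent (m d : nat) (F : marked m d) (B : {set vertex F}) : Prop :=
  forall c,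
    {in B &, forall x x', dir F c x = dir F c x'} /\
    exists2 C, C \in porbits (fact F c) & B \subset C.

(* G is the set of vertices strictly between two consecutive U-vertices
   u and s^r u of the cycle C; when C meets U only in u, r is #|C|. *)
Definition open_gap (T : finType) (s : {perm T}) (U C G : {set T}) : Prop :=
  exists u r,
    [/\ u \in U :&: C, (0 < r)%N, (s ^+ r)%g u \in U,
        forall k, (0 < k < r)%N -> (s ^+ k)%g u \notin U
      & G = [set (s ^+ (k : nat))%g u | k : 'I_r & (0 < k)%N]].

(* Colour-cycle labels. *)
Definition label (m d : nat) (F : marked m d) : finType :=
  {l : 'I_d * {set vertex F} | l.2 \in porbits (fact F l.1)}.

Definition block_in_cycle (m d : nat) (F : marked m d) (i : 'I_(ncoord F))
    (y : base F) (l : label F) : bool :=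
  (fibre y \subset (val l).2) && [forall x in fibre y, dir F (val l).1 x == i].

Definition incidence (m d : nat) (F : marked m d) (i : 'I_(ncoord F)) :
    rel (base F + label F)%type :=
  fun v w => match v, w with
    | inl y, inr l | inr l, inl y => block_in_cycle i y l
    | _, _ => false
    end.

Record admissible (m d : nat) (F : marked m d) : Prop := Admissible {
  adm_fact : factorization F;
  adm_ident : bijective (ident F);
  adm_fibre : forall y : base F, cycle_consistent (fibre y);
  adm_dist : forall (x : vertex F) i,
    (#|[set c in distinguished F | dir F c x == i]| <= 1)%N;
  adm_mark : forall x, x \in mark F -> (ident F x).2 = 0;
  adm_gap : forall c C, c \in distinguished F -> C \in porbits (fact F c) ->
    C :&: mark F != set0 ->
    exists2 G, open_gap (fact F c) (mark F) C G &
      forall x, x \in C -> (ident F x).2 != 0 -> x \in G;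
  adm_even : forall i, (2 <= multiplicity F i)%N ->
    forall v, ~~ odd #|[set l : label F | connect (incidence i) v (inr l)]| }.

Definition recolouring (m d : nat) (F : marked m d)
    (sigma : vertex F -> {perm 'I_d}) (S' : 'I_d -> {perm (vertex F)}) : Prop :=
  (forall x, x \in mark F -> perm_on (distinguished F) (sigma x)) /\
  (forall c x, S' c x =
     if (x \in mark F) && (c \in distinguished F) then fact F (sigma x c) x
     else fact F c x).

Section Split.
Variables (m n : nat) (i : 'I_n).

(* In 'I_n.+1 the new coordinate comes right after coordinate i, and
   [lift split_coord] is the increasing renumbering of the old ones. *)
Definition split_coord : 'I_n.+1 := lift ord0 i.

Definition split_in (xt : torus m n * 'Z_m) : torus m n.+1 :=
  [ffun p => if unlift split_coord p is Some j
             then if j == i then xt.1 j - xt.2 else xt.1 j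
             else xt.2].

Definition split_out (z : torus m n.+1) : torus m n * 'Z_m :=
  ([ffun j => if j == i then z (lift split_coord j) + z split_coord
              else z (lift split_coord j)],
   z split_coord).

Lemma split_inK : cancel split_in split_out.
Proof.
case=> x t; rewrite /split_out /split_in !ffunE unlift_none /=.
congr pair; apply/ffunP=> j; rewrite !ffunE liftK.
by case: eqP => // _; rewrite subrK.
Qed.

Lemma split_outK : cancel split_out split_in.
Proof.
move=> z; apply/ffunP=> p; rewrite !ffunE /=.
case: unliftP => [j ->|-> //]; rewrite ffunE.
by case: eqP => // _; rewrite addrK.
Qed.

Definition split_mult (a : 'I_n -> nat) (b : nat) (p : 'I_n.+1) : nat :=
  if unlift split_coord p is Some j then if j == i then (a i - b)%N else a j
  else b.

Definition split_fun (s : {perm (torus m n)}) (e : torus m n -> bool)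
    (z : torus m n.+1) : torus m n.+1 :=
  let: (x, t) := split_out z in split_in (s x, t + (e x)%:R).

Lemma split_fun_inj s e : injective (split_fun s e).
Proof.
move=> z z'; rewrite /split_fun.
case E: (split_out z) => [x t]; case E': (split_out z') => [x' t'].
move/(can_inj split_inK) => /pair_equal_spec [/perm_inj exx'].
rewrite -exx' => /addIr ett'.
by apply: (can_inj split_outK); rewrite E E' exx' ett'.
Qed.

Definition split_perm s e : {perm (torus m n.+1)} := perm (@split_fun_inj s e).

Definition split_dir (g : torus m n -> 'I_n) (e : torus m n -> bool)
    (z : torus m n.+1) : 'I_n.+1 :=
  let x := (split_out z).1 in
  if e x then split_coord else lift split_coord (g x).

End Split.

Definition split_choice (m d : nat) (F : marked m d) (i : 'I_(ncoord F)) (b : nat)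
    (delta : 'I_d -> vertex F -> bool) : Prop :=
  [/\ (0 < b < multiplicity F i)%N,
      forall c x, dir F c x != i -> delta c x = false
    & forall x, (\sum_c delta c x)%N = b].

Definition binary_split (m d : nat) (F : marked m d) (i : 'I_(ncoord F)) (b : nat)
    (delta : 'I_d -> vertex F -> bool) : marked m d :=
  {| ncoord := (ncoord F).+1;
     multiplicity := split_mult i (multiplicity F) b;
     fact := fun c => split_perm i (fact F c) (delta c);
     dir := fun c => split_dir i (dir F c) (delta c);
     distinguished := distinguished F;
     mark := [set split_in i (x, 0) | x in mark F];
     base := torus m (ncoord F);
     ident := @split_out m (ncoord F) i |}.

(* Off U x {0} the value is irrelevant: [recolouring] reads sigma on marks only. *)
Definition transport (m d : nat) (F : marked m d) (i : 'I_(ncoord F))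
    (sigma : vertex F -> {perm 'I_d}) (z : torus m (ncoord F).+1) : {perm 'I_d} :=
  let: (x, t) := split_out i z in if t == 0 then sigma x else 1%g.

(* By [split_mult], direction i keeps a - a./2, i.e. the upper half of a. *)
Record good_split (m d : nat) (F : marked m d) (i : 'I_(ncoord F))
    (delta : 'I_d -> vertex F -> bool) : Prop := GoodSplit {
  gs_choice : split_choice i (multiplicity F i)./2 delta;
  gs_admissible : admissible (binary_split i (multiplicity F i)./2 delta);
  gs_transport : forall sigma S', recolouring sigma S' ->
    exists2 S'', @recolouring m d (binary_split i (multiplicity F i)./2 delta)
                   (transport i sigma) S'' &
      forall c, #|porbits (S'' c)| = #|porbits (S' c)| }.

Inductive split_seq (m d : nat) (F : marked m d) : Type :=
| SplitStop
| SplitStep (i : 'I_(ncoord F)) (delta : 'I_d -> vertex F -> bool)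
    of (2 <= multiplicity F i)%N & good_split i delta
    & split_seq (binary_split i (multiplicity F i)./2 delta).

Fixpoint split_size (m d : nat) (F : marked m d) (q : split_seq F) : nat :=
  match q with
  | SplitStop => 0
  | SplitStep _ _ _ _ q' => (split_size q').+1
  end.

Fixpoint split_end (m d : nat) (F : marked m d) (q : split_seq F) : marked m d :=
  match q with
  | SplitStop => F
  | SplitStep _ _ _ _ q' => split_end q'
  end.

Fixpoint transport_seq (m d : nat) (F : marked m d) (q : split_seq F) :
    (vertex F -> {perm 'I_d}) -> vertex (split_end q) -> {perm 'I_d} :=
  match q return (vertex F -> {perm 'I_d}) -> vertex (split_end q) -> {perm 'I_d} with
  | SplitStop => fun sigma => sigma
  | SplitStep i _ _ _ q' => fun sigma => @transport_seq _ _ _ q' (transport i sigma)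
  end.

Arguments transport_seq {m d F} q sigma _.

(* Main.v *)
Require Import Defs.
From mathcomp Require Import all_boot all_order all_fingroup all_algebra.
From mathcomp Require Import zify ring.

Set Implicit Arguments.
Unset Strict Implicit.
Unset Printing Implicit Defensive.

Import Order.TTheory GRing.Theory Num.Theory.
Local Open Scope ring_scope.

(** Write a for the multiplicity of direction i and b for its lower half. A
    split of direction i is a choice, at each vertex, of b of the a colours
    that use i there. Every cycle C of a colour c lifts to a single cycle
    exactly when the number of chosen vertices of C, its total, is a unit mod
    m; the fibres over the old vertices are then cycle-consistent, and the old
    and new colour-cycle labels are in bijection.

    Totals +1 or -1 are obtained from a flow. In the block-cycle incidence
    graph of direction i every component has an even number of cycle columns,
    so the columns can be joined in pairs by paths (a T-join); orienting the
    T-join as evenly as possible gives signs -1, 0, 1 on the edges that sum to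
    0 at every block and to +1 or -1 at every column ([unit_flow]). Inside a
    block, a colour of sign +1 is chosen once, a colour of sign -1 is chosen
    m - 1 times, and the colours of sign 0 are chosen always or never
    ([block_pattern]). As at most one distinguished colour uses i in a block,
    no distinguished colour need be chosen at last coordinate 0. So on a
    distinguished cycle that meets the marks, all the chosen vertices lie in
    the one open gap that contains the nonzero last coordinates; the lifted
    cycle then visits all its marked vertices while its new coordinate is 0,
    and everything else is one gap ([split_gap]).

    The parity condition survives for a direction other than i because its
    graph only has its blocks replicated m times. For a child of i, count the
    edges of a component: each column has odd degree since its total is a
    unit modulo the even number m, and each block has the same degree. So it
    suffices that the number of blocks is even, which holds because the m new
    blocks over an old fibre lie in the same component when the child has
    multiplicity at least 2: along a fibre, the sets of chosen colours (and
    likewise their complements) all meet one of them ([split_even_child]).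

    A recolouring and its transport have equally many cycles: sending x to
    (x,0), and sending (x,t) with t nonzero to the end of the gap of the cycle
    of x (or to x if that cycle has no mark), carries cycles to cycles in both
    directions ([card_porbits_transported]). Finally each split adds one coordinate and
    keeps the sum d of the multiplicities, which are positive, so they are all
    1 exactly when there are d coordinates. *)

(** * Balanced flows on graphs *)

Section Orientation.
Variable V : finType.
Implicit Types (e J : rel V) (f g : V -> V -> int) (T : {set V}).

Definition parity J v : bool := \big[addb/false]_w J v w.

(** Toggling the edges of a walk one after the other changes the parity of the
    degree only at the two ends of the walk. *)
Lemma toggle_path e J v w :
    symmetric e -> irreflexive e -> symmetric J -> subrel J e -> connect e v w ->
  exists J', [/\ symmetric J', subrel J' e
    & forall x, parity J' x = parity J x (+) (x == v) (+) (x == w)].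
Proof.
move=> eC eI + + /connectP[p]; elim: p v J => [|y p IHp] v J JC Je /=.
  by move=> _ ->; exists J; split=> // x; rewrite -addbA addbb addbF.
case/andP=> evy path_p last_p.
have vy : v != y by apply: contraTneq evy => ->; rewrite eI.
pose J1 : rel V := fun x z => J x z (+) ((x == v) && (z == y)) (+) ((x == y) && (z == v)).
have J1C : symmetric J1.
  move=> x z; rewrite /J1 JC -!addbA; congr addb; rewrite addbC.
  by congr addb; rewrite andbC.
have J1e : subrel J1 e.
  move=> x z; rewrite /J1; case: (boolP ((x == v) && (z == y))) => [/andP[/eqP-> /eqP->] //|_].
  case: (boolP ((x == y) && (z == v))) => [/andP[/eqP-> /eqP->]|_]; first by rewrite eC.
  by rewrite !addbF => /Je.
have [J' [J'C J'e J'P]] := IHp y J1 J1C J1e path_p last_p.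
exists J'; split=> // x; rewrite J'P; congr addb.
have ind (a b : V) : \big[addb/false]_z ((x == a) && (z == b)) = (x == a).
  rewrite (bigD1 b) //= eqxx andbT big1 ?addbF // => z /negbTE ->.
  by rewrite andbF.
by rewrite /parity /J1 !big_split /= !ind -!addbA addbb addbF.
Qed.

(** Existence of T-joins: a component contains at least two vertices of T as
    soon as it contains one, and joining two of them by a path reduces T. *)
Lemma join_subgraph e T :
    symmetric e -> irreflexive e ->
    (forall v, ~~ odd #|[set w in T | connect e v w]|) ->
  exists J, [/\ symmetric J, subrel J e & forall v, parity J v = (v \in T)].
Proof.
move=> eC eI; have [k] := ubnP #|T|; elim: k T => // k IHk T leTk evT.
have [T0|[v vT]] := set_0Vmem T.
  exists (fun _ _ => false); split=> // x.
  by rewrite T0 inE /parity big1.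
have [w]: exists w, w \in [set w in T | connect e v w] :\ v.
  apply/set0Pn; rewrite -cards_eq0; have := evT v.
  by rewrite (cardsD1 v) !inE vT connect0; case: eqP => [->|].
rewrite !inE => /and3P[wv wT cvw].
have [|x|J [JC Je JP]] := IHk (T :\ v :\ w).
- have := leTk; rewrite (cardsD1 v) vT (cardsD1 w (T :\ v)) !inE wv wT /=.
  by move/ltnW.
- have := evT x; rewrite (cardsD1 v) (cardsD1 w (_ :\ v)) !inE wv vT wT /=.
  rewrite -(same_connect_r (sym_connect_sym eC) cvw) addnA addnn oddD odd_double /=.
  by congr (~~ odd #|pred_of_set _|); apply/setP=> y; rewrite !inE !andbA.
have [J' [J'C J'e J'P]] := toggle_path eC eI JC Je cvw.
exists J'; split=> // x; rewrite J'P JP !inE.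
case: (x =P w) => [->|_]; first by rewrite wT (negbTE wv).
by case: (x =P v) => [->|_] //=; rewrite addbF ?vT // addbF.
Qed.

Definition excess f v : int := \sum_w f v w.

(** Reversing a directed path moves two units of excess from its origin to
    its end. The path has to be simple, so that no arc is reversed twice. *)
Lemma reverse_path f v p :
    (forall x y, f x y = - f y x) -> path (fun x y => f x y == 1) v p -> uniq (v :: p) ->
  exists g, [/\ forall x y, g x y = - g y x, forall x y, `|g x y| = `|f x y|
    & forall x, excess g x = excess f x - (x == v)%:R *+ 2 + (x == last v p)%:R *+ 2].
Proof.
elim: p v f => [|y p IHp] v f fA /=.
  by move=> _ _; exists f; split=> // x; rewrite subrK.
case/andP=> /eqP fvy path_p /andP[vNyp Uyp].
have vy : v != y by move: vNyp; rewrite inE negb_or => /andP[].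
have fyv : f y v = -1 by rewrite fA fvy.
pose g x z : int := f x z - ((x == v) && (z == y))%:R *+ 2 + ((x == y) && (z == v))%:R *+ 2.
have gA x z : g x z = - g z x.
  by rewrite /g fA [(z == v) && _]andbC [(z == y) && _]andbC; ring.
have gabs x z : `|g x z| = `|f x z|.
  rewrite /g; have [->|xv] := eqVneq x v; have [->|zy] := eqVneq z y => /=.
  - by rewrite (negbTE vy) fvy.
  - by rewrite (negbTE vy) subr0 addr0.
  - by rewrite [y == v]eq_sym (negbTE vy) andbF subr0 addr0.
  have [->|xy] := eqVneq x y; have [->|zv] := eqVneq z v => //=; rewrite ?subr0 ?addr0 //.
  by rewrite fyv.
have path_g : path (fun x y => g x y == 1) y p.
  rewrite (eq_in_path (P := predC1 v) (e' := fun x y => f x y == 1)) //.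
    move=> x z; rewrite !inE /g => /negbTE-> /negbTE->.
    by rewrite andbF subr0 addr0.
  by apply/allP=> z zyp /=; apply: contraNneq vNyp => <-.
have [h [hA habs hx]] := IHp y g gA path_g Uyp.
exists h; split=> // [x z|x]; first by rewrite habs.
rewrite hx; congr (_ + _).
have ind (a b : V) : \sum_z ((x == a) && (z == b))%:R = (x == a)%:R :> int.
  by rewrite (bigD1 b) //= eqxx andbT big1 ?addr0 // => z /negbTE ->; rewrite andbF.
have -> : excess g x = excess f x - (x == v)%:R *+ 2 + (x == y)%:R *+ 2.
  by rewrite /excess !big_split /= sumrN !sumrMnl !ind.
by rewrite addrK.
Qed.

(** Inside R the flow cancels by antisymmetry. *)
Lemma excess_set f (R : {set V}) :
  (forall x y, f x y = - f y x) ->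
  \sum_(v in R) excess f v = \sum_(v in R) \sum_(w in ~: R) f v w.
Proof.
move=> fA; rewrite /excess.
under eq_bigr => v _ do rewrite (bigID (mem R)) /=.
rewrite big_split /= [X in X + _](_ : _ = 0) ?add0r.
  by apply: eq_bigr => v _; apply: eq_bigl => w; rewrite inE.
set s := (X in X = 0); have : s = - s.
  rewrite {1}/s exchange_big /s -sumrN; apply: eq_bigr => v _.
  by rewrite -sumrN; apply: eq_bigr => w _; apply: fA.
lia.
Qed.

(** No arc leaves the set of vertices reachable from v, so its total excess is
    at most 0, and some reachable vertex compensates for the excess of v.
    Reversing a path from v to that vertex improves the balance. *)
Lemma reduce_excess f v :
    (forall x y, f x y = - f y x) -> (forall x y, `|f x y| <= 1) -> 2 <= excess f v ->
  exists g, [/\ forall x y, g x y = - g y x, forall x y, `|g x y| = `|f x y|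
    & (\sum_x `|excess g x|%N < \sum_x `|excess f x|%N)%N].
Proof.
move=> fA f1 ex_v; pose o := fun x y => f x y == 1.
have [w wR ex_w] : exists2 w, connect o v w & excess f w < 0.
  apply/exists_inP; apply: contraLR ex_v; rewrite negb_exists_in -ltNge.
  move/forall_inP=> exR; pose R := [set w | connect o v w].
  have leS : \sum_(x in R) excess f x <= 0.
    rewrite excess_set //; apply: sumr_le0 => x xR; apply: sumr_le0 => y.
    rewrite !inE => yR; have := f1 x y; suff : f x y != 1 by lia.
    apply: contraNneq yR => fxy; rewrite inE in xR.
    by apply: connect_trans xR (connect1 _); apply/eqP.
  have vR : v \in R by rewrite inE.
  have : 0 <= \sum_(x in R | x != v) excess f x.
    by apply: sumr_ge0 => x /andP[]; rewrite inE => /exR; rewrite -leNgt.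
  move: leS; rewrite (bigD1 v) //=.
  by set X := (\sum_(_ | _) _); lia.
case/connectP: wR => p0 /shortenP[p path_p Up _] def_w.
have [g [gA gabs gx]] := reverse_path fA path_p Up.
exists g; split=> //; rewrite -def_w in gx.
have wv : w != v by apply: contraTneq ex_w => ->; lia.
rewrite (bigD1 v) // (bigD1 w) //=.
rewrite [X in (_ < X)%N](bigD1 v) // [X in (_ < _ + X)%N](bigD1 w) //=.
rewrite !gx !eqxx [v == w]eq_sym (negbTE wv) /=.
rewrite [X in (_ + (_ + X) < _)%N](_ : _ = \sum_(i | (i != v) && (i != w)) `|excess f i|)%N.
  by set X := (\sum_(i | _) _)%N; move: (excess f v) (excess f w) ex_v ex_w => a b; lia.
by apply: eq_bigr => x /andP[/negbTE xv /negbTE xw]; rewrite gx xv xw subr0 addr0.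
Qed.

(** Repeat [reduce_excess]; an excess at most -2 becomes at least 2 when all
    the arcs are reversed. *)
Lemma balanced_orientation f :
    (forall x y, f x y = - f y x) -> (forall x y, `|f x y| <= 1) ->
  exists g, [/\ forall x y, g x y = - g y x, forall x y, `|g x y| = `|f x y|
    & forall v, `|excess g v| <= 1].
Proof.
have [k] := ubnP (\sum_x `|excess f x|)%N; elim: k f => // k IHk f ltk fA f1.
have [/forallP ex1 | ] := boolP [forall v, `|excess f v| <= 1]; first by exists f.
rewrite negb_forall => /existsP[v exv].
have [h [hA habs lth]] : exists h, [/\ forall x y, h x y = - h y x,
    forall x y, `|h x y| = `|f x y|
    & (\sum_x `|excess h x|%N < \sum_x `|excess f x|%N)%N].
  have [ge2|lt2] := lerP 2 (excess f v); first exact: (reduce_excess (v := v)).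
  have exN x : excess (fun x y => - f x y) x = - excess f x by rewrite /excess sumrN.
  have [x y|x y||h [hA habs lth]] := @reduce_excess (fun x y => - f x y) v.
  - by rewrite fA.
  - by rewrite normrN.
  - by rewrite exN; lia.
  exists h; split=> // [x y|]; first by rewrite habs normrN.
  by congr (_ < _)%N: lth; apply: eq_bigr => x _; rewrite exN abszN.
have [|||g [gA gabs g1]] := IHk h.
- by apply: leq_trans lth _.
- exact: hA.
- by move=> x y; rewrite habs.
by exists g; split=> // x y; rewrite gabs.
Qed.

(** A T-join has odd degree exactly on T; in a balanced orientation of it an
    odd degree gives an excess +1 or -1, and an even degree gives 0. *)
Lemma unit_flow e T :
    symmetric e -> irreflexive e ->
    (forall v, ~~ odd #|[set w in T | connect e v w]|) ->
  exists f, [/\ forall x y, f x y = - f y x, forall x y, `|f x y| <= (e x y)%:R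
    & forall v, `|excess f v| = (v \in T)%:R].
Proof.
move=> eC eI evT; have [J [JC Je JP]] := join_subgraph eC eI evT.
(* Any orientation of J will do as a start; this one orients by rank. *)
pose f0 x y : int := (J x y)%:R * (-1) ^+ (enum_rank x < enum_rank y)%N.
have f0A x y : f0 x y = - f0 y x.
  rewrite /f0 JC; have [->|xy] := eqVneq x y.
    by case Jyy: (J y y); rewrite ?mul0r ?oppr0 //; move/Je: Jyy; rewrite eI.
  rewrite -mulrN; congr (_ * _); case: ltngtP => //= /val_inj/enum_rank_inj.
  by move/eqP; rewrite (negbTE xy).
have f0abs x y : `|f0 x y| = J x y.
  by rewrite normrM normr_nat normrX normrN1 expr1n mulr1; case: (J x y).
have [x y|f [fA fabs f1]] := balanced_orientation f0A.
  by rewrite f0abs; case: (J x y).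
exists f; split=> // [x y|v].
  by rewrite fabs f0abs; case Jxy: (J x y) => //; rewrite (Je _ _ Jxy).
have := f1 v; have : odd `|excess f v| = (v \in T).
  rewrite -JP /parity /excess.
  rewrite (big_morph (fun z : int => odd `|z|) (id1 := false) (op1 := addb)) //.
    by apply: eq_bigr => w _; have := fabs v w; rewrite f0abs; lia.
  by move=> a b; lia.
by case: (v \in T); lia.
Qed.

End Orientation.

(** * Colour sets along one fibre *)

Lemma subset_of_card (T : finType) (A : {set T}) k :
  (k <= #|A|)%N -> exists2 B : {set T}, B \subset A & #|B| = k.
Proof.
move=> lekA; have : (0 < #|[set B : {set T} | B \subset A & #|B| == k]|)%N.
  by rewrite cards_draws bin_gt0.
by case/card_gt0P=> B; rewrite inE => /andP[? /eqP]; exists B.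
Qed.

(** The positive and negative colours are divided into two classes, which
    will be exchanged at two different times. The first exchange takes place
    at time 0 and must leave no element of A in use: so P1 avoids A and N1
    takes the possible element of N in A. *)
Lemma sign_split (I : finType) (A P N : {set I}) :
    [disjoint P & N] -> #|P| = #|N| -> (#|(P :|: N) :&: A| <= 1)%N ->
  exists P1 N1 : {set I}, [/\ P1 \subset P, N1 \subset N, #|P1| = #|N1|,
    [disjoint P1 & A] /\ [disjoint N :\: N1 & A]
    & (2 <= #|P|)%N -> [/\ P1 != set0, N1 != set0, P :\: P1 != set0 & N :\: N1 != set0]].
Proof.
move=> dPN cPN A1.
have only c c' : c \in P :|: N -> c \in A -> c' \in P :|: N -> c' \in A -> c = c'.
  move=> cE cA c'E c'A; apply: (card_le1_eqP A1); rewrite inE ?cE ?cA //.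
  by rewrite c'E.
(* If P is contained in A, it has at most one element and N misses A, so
   that nothing has to be exchanged at time 0. *)
have [|[p]] := set_0Vmem (P :\: A).
  move/eqP; rewrite setD_eq0 => PA; exists set0, set0.
  rewrite !sub0set setD0 -!setI_eq0 set0I eqxx; split=> //.
    split=> //; rewrite -subset0; apply/subsetP=> c /setIP[cN cA].
    have /card_gt0P[q qP] : (0 < #|P|)%N by rewrite cPN; apply/card_gt0P; exists c.
    have qc : q = c by apply: only; rewrite ?(subsetP PA q) ?inE ?qP ?cN ?orbT.
    by move: (disjointFr dPN qP); rewrite qc cN.
  move=> P2; have := A1; rewrite leqNgt => /negP[].
  apply: leq_trans P2 _; apply: subset_leq_card; apply/subsetP=> c cP.
  by rewrite !inE cP (subsetP PA).
rewrite inE => /andP[pA pP].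
have [n nN nA] : exists2 n, n \in N & [disjoint N :\ n & A].
  have [NA|[n /setIP[nN nA]]] := set_0Vmem (N :&: A).
    have /card_gt0P[n nN] : (0 < #|N|)%N by rewrite -cPN; apply/card_gt0P; exists p.
    exists n => //; rewrite -setI_eq0 -subset0 -NA; apply: setSI.
    exact: subsetDl.
  exists n => //; rewrite -setI_eq0 -subset0; apply/subsetP=> c.
  rewrite !inE => /andP[/andP[cn cN] cA]; case/eqP: cn.
  by apply: only; rewrite ?inE ?nN ?cN ?orbT.
exists [set p], [set n]; rewrite !sub1set pP nN !cards1 disjoints1 pA; split=> //.
move=> P2; rewrite -!cards_eq0 !cards1; split=> //.
  by move: P2; rewrite (cardsD1 p) pP; case: #|_|.
by move: P2; rewrite cPN (cardsD1 n) nN; case: #|_|.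
Qed.

(** The colours with f c = -1 and enough colours with f c = 0 are used by
    default; at time 0 the members P1 of P replace the members N1 of N, and at
    time 1 the others are exchanged. So a colour of P is used once and one of
    N is used m - 1 times. A third time s = 2, with no exchange, has a set
    that shares an element with any other: a permanently used colour, or, when
    there is none, a member of N1 or of its complement in N. The same holds
    for complements, with P instead of N. *)
Lemma block_pattern (m : nat) (I : finType) (E A : {set I}) (f : I -> int) :
    (3 <= m)%N -> (#|E :&: A| <= 1)%N ->
    (forall c, `|f c| <= (c \in E)%:R) -> \sum_c f c = 0 ->
  exists D : 'Z_m -> {set I},
    [/\ forall t, D t \subset E, forall t, #|D t| = #|E|./2, [disjoint D 0 & A],
        forall c, (\sum_t (c \in D t))%:R = (f c)%:~R :> 'Z_m
      & exists s, forall t,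
        ((2 <= #|E|./2)%N -> D t :&: D s != set0) /\
        ((2 <= #|E| - #|E|./2)%N -> (E :\: D t) :&: (E :\: D s) != set0)].
Proof.
move=> m3 EA fE f0; set a := #|E|; set b := a./2.
pose P := [set c | f c == 1]; pose N := [set c | f c == -1].
have fPN c : f c = (c \in P)%:R - (c \in N)%:R.
  by rewrite !inE; have := fE c; case: (c \in E); lia.
have dPN : [disjoint P & N].
  by apply/pred0P=> c /=; rewrite !inE; case: eqP => // ->.
have cPN : #|P| = #|N|.
  have : \sum_c f c = #|P|%:Z - #|N|%:Z.
    under eq_bigr do rewrite fPN.
    have ind (Q : {set I}) : \sum_c (c \in Q)%:R = #|Q|%:Z.
      rewrite -natr_sum natz -sum1_card [in RHS]big_mkcond /=.
      by congr Posz; apply: eq_bigr => c _; case: (c \in Q).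
    by rewrite sumrB !ind.
  by rewrite f0; lia.
have PE : P \subset E.
  by apply/subsetP=> c; rewrite inE => /eqP fc; have := fE c; rewrite fc; case: (c \in E).
have NE : N \subset E.
  by apply/subsetP=> c; rewrite inE => /eqP fc; have := fE c; rewrite fc; case: (c \in E).
set p := #|P|; pose Z := E :\: (P :|: N).
have cZ : (#|Z| + p.*2 = a)%N.
  rewrite /a -addnn {2}/p cPN -(cardsID (P :|: N) E) addnC; congr addn.
  by rewrite (setIidPr _) ?subUset ?PE // cardsU (disjoint_setI0 dPN) cards0 subn0.
have PNA : (#|(P :|: N) :&: A| <= 1)%N.
  by apply: (leq_trans _ EA); apply: subset_leq_card; apply: setSI; rewrite subUset PE.
have leb : (p <= b)%N by rewrite /b; clear -cZ; lia.
have [P1 [N1 [P1P N1N cPN1 [P1A NA] big2]]] := sign_split dPN cPN PNA.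
(* Y consists of the zeros in permanent use; they are chosen outside A. *)
have leZA : (b - p <= #|Z :\: A|)%N.
  have := cardsID A Z; have : (#|Z :&: A| <= 1)%N.
    by apply: (leq_trans _ EA); apply: subset_leq_card; apply: setSI; exact: subsetDl.
  rewrite /b; lia.
have [Y YZ cY] := subset_of_card leZA.
have [YsZ YA] : Y \subset Z /\ [disjoint Y & A].
  split; first exact: subset_trans YZ (subsetDl _ _).
  apply: disjointWl YZ _; apply/pred0P=> c /=.
  by rewrite inE; case: (c \in A); rewrite ?andbF.

have YE : Y \subset E by apply: subset_trans YsZ (subsetDl _ _).
have YP c : (c \in Y) ==> (c \notin P) && (c \notin N).
  apply/implyP=> /(subsetP YsZ); rewrite in_setD in_setU negb_or.
  by case/andP.
have PN c : (c \in P) ==> (c \notin N) by apply/implyP=> cP; rewrite (disjointFr dPN).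
have P1P' c : (c \in P1) ==> (c \in P) by apply/implyP/subsetP.
have N1N' c : (c \in N1) ==> (c \in N) by apply/implyP/subsetP.
pose D (t : 'Z_m) := Y :|: (if t == 0 then P1 else N1)
                       :|: (if t == 1 then P :\: P1 else N :\: N1).
have cardZm : #|'Z_m| = m by rewrite card_ord Zp_cast // ltnW.
have n01 : (0 == 1 :> 'Z_m) = false by [].
have Dsum t c : (c \in D t) = ((c \in Y) + (if t == 0%R then c \in P1 else c \in N1)
    + (if t == 1%R then c \in P :\: P1 else c \in N :\: N1))%N :> nat.
  have := P1P' c; have := N1N' c; have := YP c; have := PN c; rewrite /D.
  by case: (t == 0); case: (t == 1); rewrite !in_setU ?in_setD;
    case: (c \in P1); case: (c \in N1); case: (c \in P); case: (c \in N);
    case: (c \in Y).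
have cardD t : #|D t| = b.
  have ind (Q : {set I}) : #|Q| = (\sum_c (c \in Q))%N.
    by rewrite -sum1_card [LHS]big_mkcond /=; apply: eq_bigr => c _; case: (c \in Q).
  rewrite ind; under eq_bigr do rewrite Dsum; rewrite !big_split /=.
  have P12 := cardsID P1 P; rewrite (setIidPr P1P) -/p in P12.
  have N12 := cardsID N1 N; rewrite (setIidPr N1N) -cPN -/p in N12.
  by case: (t == 0); case: (t == 1); rewrite -!ind cY; clear -leb P12 N12 cPN1; lia.
exists D; split.
- move=> t; rewrite !subUset YE; case: ifP => _; case: ifP => _;
    rewrite ?(subset_trans P1P PE) ?(subset_trans N1N NE) //=.
  + exact: subset_trans (subsetDl _ _) PE.
  + exact: subset_trans (subsetDl _ _) NE.
  + exact: subset_trans (subsetDl _ _) PE.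
  + exact: subset_trans (subsetDl _ _) NE.
- by move=> t; rewrite cardD.
- rewrite /D eqxx n01 -!setI_eq0 !setIUl !setU_eq0.
  by rewrite !setI_eq0 YA P1A NA.
- move=> c.
  have sumD : (\sum_t (c \in D t) = (c \in Y) * m + (c \in P) + (c \in N) * (m - 1))%N.
    under eq_bigr do rewrite Dsum.
    rewrite !big_split /= sum_nat_const cardZm mulnC.
    have sum_if (t0 : 'Z_m) (x y : bool) :
        (\sum_t (if t == t0 then x else y) = x + y * (m - 1))%N.
      rewrite (bigD1 t0) //= eqxx; congr addn.
      rewrite (eq_bigr (fun _ => y : nat)); last by move=> t /negbTE->.
      by rewrite sum_nat_const cardC1 cardZm mulnC subn1.
    rewrite !sum_if.
    have := P1P' c; have := N1N' c; rewrite !in_setD.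
    by case: (c \in P1); case: (c \in N1); case: (c \in P); case: (c \in N) => //= _ _; clear; lia.
  rewrite sumD fPN.
  have m1 : (1 < m)%N := ltnW m3.
  rewrite !natrD !natrM natrB ?(ltnW m1) // pchar_Zp // mulr0 add0r sub0r mulrN1.
  by rewrite rmorphB /= !rmorph_nat.
have D2 t : t != 0 -> t != 1 -> D t = Y :|: N.
  move=> /negbTE t0 /negbTE t1; rewrite /D t0 t1.
  by rewrite -setUA setDE setUIr setUCr setIT (setUidPr N1N).
have two0 : (2%:R : 'Z_m) != 0.
  by apply/eqP=> /(congr1 (@nat_of_ord _)); rewrite val_Zp_nat ?(ltnW m3) // modn_small.
have two1 : (2%:R : 'Z_m) != 1.
  by rewrite -subr_eq0 -[2%:R]/(1 + 1) addrK oner_eq0.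
exists 2%:R => t; rewrite (D2 _ two0 two1); split=> b2; apply/set0Pn.
- have [Y0|[c cY']] := set_0Vmem Y; last by exists c; rewrite /D !in_setI !in_setU cY'.
  have /big2[_ /set0Pn[n1 n1N] _ /set0Pn[n2 n2N]] : (2 <= #|P|)%N.
    by move: cY; rewrite Y0 cards0 -/p; clear -leb b2; lia.
  have [->|t0] := eqVneq t 0.
    exists n2; rewrite /D eqxx n01 !in_setI !in_setU n2N orbT /=.
    by move: n2N; rewrite in_setD => /andP[_ ->]; rewrite orbT.
  exists n1; rewrite /D (negbTE t0) !in_setI !in_setU n1N orbT /=.
  by rewrite (implyP (N1N' _)) // orbT.
have [Y0|[c]] := set_0Vmem (Z :\: Y).
  have /big2[/set0Pn[n1 n1P] _ /set0Pn[n2 n2P] _] : (2 <= #|P|)%N.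
    have := cardsID Y Z; rewrite (setIidPr YsZ) Y0 cards0 cY -/p.
    by move: b2 cZ; rewrite -/b /b; clear; lia.
  have [->|t0] := eqVneq t 0.
    move: n2P; rewrite in_setD => /andP[n21 n2P].
    exists n2; rewrite /D eqxx n01 !in_setI !in_setD !in_setU !in_setD (subsetP PE) // !andbT.
    have := YP n2; have := PN n2; rewrite n2P /= => /negbTE->.
    by rewrite (negbTE n21) andbF !orbF implybF => ->.
  exists n1; rewrite /D (negbTE t0) !in_setI !in_setD !in_setU.
  have n1P' := implyP (P1P' _) n1P; rewrite (subsetP PE) // !andbT.
  have := YP n1; have := PN n1; have := N1N' n1; rewrite n1P' /= implybF => + /negbTE n1N.
  rewrite n1N implybF => /negbTE-> /negbTE->.
  by case: (t == 1); rewrite in_setD ?n1P ?n1N ?andbF.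
rewrite !in_setD in_setU negb_or => /andP[cY' /andP[/andP[cP cN] cE]].
exists c; rewrite !in_setI !in_setD /D !in_setU cE (negbTE cY') (negbTE cN) /= !andbT.
have := P1P' c; have := N1N' c; rewrite (negbTE cP) (negbTE cN) !implybF.
move=> /negbTE c1 /negbTE c2.
by case: (t == 0); case: (t == 1); rewrite !in_setD ?c1 ?c2 ?(negbTE cP) ?(negbTE cN).
Qed.

(** * Cycles of a permutation *)

Section PermOrbits.
Variable T : finType.
Implicit Types (s : {perm T}) (U C : {set T}).

Lemma porbit_step s x : s x \in porbit s x.
Proof. by rewrite -[s x]/((s ^+ 1)%g x) mem_porbit. Qed.

Lemma porbit_succ s x : porbit s (s x) = porbit s x.
Proof. by apply/eqP; rewrite eq_porbit_mem porbit_step. Qed.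

Lemma expg_agree s (s' : {perm T}) U x n :
    (forall y, y \notin U -> s' y = s y) ->
    (forall k, (k < n)%N -> (s ^+ k)%g x \notin U) ->
  (s' ^+ n)%g x = (s ^+ n)%g x.
Proof.
move=> ss' nU; elim: n nU => [|n IHn] nU; first by rewrite !expg0.
rewrite !expgSr !permM IHn ?ss' ?nU // => k ltkn; apply: nU; exact: ltnW.
Qed.

Lemma expg_card_porbit s x : (s ^+ #|porbit s x|)%g x = x.
Proof. by rewrite permX iter_porbit. Qed.

Lemma porbit_index s x y : y \in porbit s x ->
  exists2 k, (k < #|porbit s x|)%N & y = (s ^+ k)%g x.
Proof.
rewrite porbit_traject => /trajectP[k ltk ->]; exists k => //.
by rewrite permX.
Qed.

Lemma expg_porbit_inj s x j k : (j < #|porbit s x|)%N -> (k < #|porbit s x|)%N ->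
  (s ^+ j)%g x = (s ^+ k)%g x -> j = k.
Proof.
move=> ltj ltk; rewrite !permX => Ejk; apply/eqP.
have := uniq_traject_porbit s x; set n := #|_| in ltj ltk * => Un.
by rewrite -(nth_uniq x _ _ Un) ?size_traject // !nth_traject // Ejk.
Qed.

End PermOrbits.

Lemma porbit_morph (T T' : finType) (s : {perm T}) (s' : {perm T'}) (h : T' -> T) z z' :
    (forall z, h (s' z) \in porbit s (h z)) -> z' \in porbit s' z ->
  porbit s (h z') = porbit s (h z).
Proof.
move=> hP /porbitP[k ->]; elim: k => [|k IHk]; first by rewrite expg0 perm1.
by rewrite expgSr permM -IHk; apply/eqP; rewrite eq_porbit_mem; apply: hP.
Qed.

(** A map that sends cycles of s' into cycles of s, and that meets every
    cycle of s, induces a surjection between the sets of cycles. *)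
Lemma leq_card_porbits (T T' : finType) (s : {perm T}) (s' : {perm T'}) (h : T' -> T) :
    (forall z, h (s' z) \in porbit s (h z)) ->
    (forall x, exists z, h z \in porbit s x) ->
  (#|porbits s| <= #|porbits s'|)%N.
Proof.
move=> hP h_onto; pose F (C : {set T'}) := \bigcup_(z in C) porbit s (h z).
apply: leq_trans (leq_imset_card F _); apply: subset_leq_card.
apply/subsetP=> _ /imsetP[x _ ->]; have [z hz] := h_onto x.
apply/imsetP; exists (porbit s' z); first exact: imset_f.
transitivity (porbit s (h z)); first by apply/esym/eqP; rewrite eq_porbit_mem.
apply/setP=> y; apply/idP/bigcupP=> [yz|[z' z'z]]; first by exists z; rewrite ?porbit_id.
by rewrite (porbit_morph hP z'z).
Qed.

(** Here the marked vertices of the cycle of v all lie on its arc from v to u,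
    of length h. The steps from u back to v then avoid the marks, and pass
    through everything that is not on the arc. *)
Lemma gap_complement (T : finType) (s : {perm T}) (U : {set T}) (u v : T) h :
    (h < #|porbit s v|)%N -> u = (s ^+ h)%g v ->
    (forall x, x \in porbit s v -> x \in U -> exists2 j, (j <= h)%N & x = (s ^+ j)%g v) ->
  let r := (#|porbit s v| - h)%N in
  [/\ (0 < r)%N, (s ^+ r)%g u = v, forall k, (0 < k < r)%N -> (s ^+ k)%g u \notin U
    & forall x, x \in porbit s v -> (forall j, (j <= h)%N -> x != (s ^+ j)%g v) ->
      exists2 k, (0 < k < r)%N & x = (s ^+ k)%g u].
Proof.
move=> lth -> hU /=; set n := #|_| in lth *; split=> [||k|x xv nx].
- by rewrite subn_gt0.
- by rewrite -permM -expgD subnKC ?expg_card_porbit // ltnW.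
- rewrite -permM -expgD => /andP[k0 ltk]; apply/negP=> /hU[|j lej Ej].
    exact: mem_porbit.
  suff : (h + k)%N = j by lia.
  by apply: expg_porbit_inj Ej; rewrite -/n; lia.
have [k ltk xE] := porbit_index xv; rewrite -/n in ltk.
have lthk : (h < k)%N by rewrite ltnNge; apply/negP=> /nx; rewrite xE eqxx.
exists (k - h)%N; first by rewrite subn_gt0 lthk ltn_sub2r.
by rewrite -permM -expgD subnKC // ltnW.
Qed.

(** * Cycles of a split permutation *)

Section SplitPerm.
Variables (m n : nat) (i : 'I_n).
Implicit Types (s : {perm torus m n}) (e : torus m n -> bool) (x : torus m n) (t : 'Z_m).

Lemma split_permE s e x t :
  split_perm i s e (split_in i (x, t)) = split_in i (s x, t + (e x)%:R).
Proof. by rewrite permE /split_fun split_inK. Qed.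

Lemma split_in_inj : injective (@split_in m n i).
Proof. exact: can_inj (@split_inK m n i). Qed.

Definition cylinder (C : {set torus m n}) : {set torus m n.+1} :=
  [set split_in i xt | xt in setX C setT].

Lemma in_cylinder C x t : (split_in i (x, t) \in cylinder C) = (x \in C).
Proof. by rewrite mem_imset ?in_setX ?in_setT ?andbT //; apply: split_in_inj. Qed.

(** The new coordinate counts the chosen vertices met along the way. *)
Lemma split_perm_exp s e x t k :
  (split_perm i s e ^+ k)%g (split_in i (x, t)) =
    split_in i ((s ^+ k)%g x, t + (\sum_(j < k) e ((s ^+ j)%g x))%:R).
Proof.
elim: k => [|k IHk]; first by rewrite !expg0 !perm1 big_ord0 addr0.
by rewrite expgSr permM IHk split_permE -permM -expgSr big_ord_recr /= natrD addrA.
Qed.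

Lemma sum_porbit (f : torus m n -> nat) s x :
  (\sum_(j < #|porbit s x|) f ((s ^+ j)%g x) = \sum_(y in porbit s x) f y)%N.
Proof.
have E : porbit s x =i [seq (s ^+ (val j))%g x | j : 'I_#|porbit s x|].
  move=> y; apply/idP/imageP=> [/porbit_index[k ltk ->]|[j _ ->]]; last exact: mem_porbit.
  by exists (Ordinal ltk).
rewrite (eq_bigl _ _ E) -big_uniq /=; first by rewrite big_image.
rewrite map_inj_uniq ?enum_uniq // => j k /expg_porbit_inj Ejk.
by apply: val_inj; apply: Ejk.
Qed.

(** The total of e over C is its own inverse mod m. This form of being a unit
    covers +1 and -1 at once and provides the inverse explicitly. *)
Definition unit_total e (C : {set torus m n}) : Prop :=
  let tau := (\sum_(x in C) e x)%:R : 'Z_m in tau * tau = 1.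

(** One turn around the cycle of x adds the total to the new coordinate; as the
    total generates Z_m, the lifted cycle contains all the sheets. *)
Lemma split_porbit s e x t : unit_total e (porbit s x) ->
  porbit (split_perm i s e) (split_in i (x, t)) = cylinder (porbit s x).
Proof.
rewrite /unit_total; set N := (\sum_(_ in _) _)%N => /= NN.
apply/setP=> z; apply/idP/idP=> [/porbitP[k ->]|].
  by rewrite split_perm_exp in_cylinder mem_porbit.
case/imsetP=> [[x' t']] /setXP[/= x'x _] ->.
have E1 t1 q : (split_perm i s e ^+ (#|porbit s x| * q))%g (split_in i (x', t1)) =
    split_in i (x', t1 + N%:R *+ q).
  have Ex : porbit s x' = porbit s x by apply/eqP; rewrite eq_porbit_mem.
  have sumN := sum_porbit e s x'; rewrite Ex -/N in sumN.
  have expN := expg_card_porbit s x'; rewrite Ex in expN.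
  elim: q => [|q IHq]; first by rewrite muln0 perm1 addr0.
  by rewrite mulnS addnC expgD permM IHq split_perm_exp expN sumN mulrSr addrA.
case/porbitP: (x'x) => k Ek.
have := split_perm_exp s e x t k; rewrite -Ek; set t1 := t + _ => E2.
have -> : t' = t1 + N%:R *+ ((t' - t1) * N%:R : 'Z_m)%R.
  by rewrite -mulr_natr natr_Zp mulrCA NN mulr1 addrC subrK.
by rewrite -E1 -E2 -permM -expgD mem_porbit.
Qed.

(** The chosen vertices lie strictly between u and s^r u. Hence the lift that
    starts at (s^r u, 0) keeps new coordinate 0 until it reaches (u, 0), and
    has then met all the marked vertices of the lifted cycle; the rest of the
    lifted cycle is a single gap. *)
Lemma split_gap s e (U : {set torus m n}) u r :
    (0 < r)%N -> u \in U -> (s ^+ r)%g u \in U ->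
    (forall k, (0 < k < r)%N -> (s ^+ k)%g u \notin U) ->
    (forall x, x \in porbit s u -> e x -> exists2 k, (0 < k < r)%N & x = (s ^+ k)%g u) ->
    unit_total e (porbit s u) ->
  let U' := [set split_in i (x, 0) | x in U] in
  exists r', [/\ (0 < r')%N,
     (split_perm i s e ^+ r')%g (split_in i (u, 0)) = split_in i ((s ^+ r)%g u, 0),
     forall k, (0 < k < r')%N -> (split_perm i s e ^+ k)%g (split_in i (u, 0)) \notin U'
   & forall x t, x \in porbit s u ->
       t != 0 \/ (exists2 k, (0 < k < r)%N & x = (s ^+ k)%g u) ->
     exists2 k, (0 < k < r')%N & split_in i (x, t) = (split_perm i s e ^+ k)%g (split_in i (u, 0))].
Proof.
move=> r0 uU srU nU eG tot U'; set N := #|porbit s u|.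
have leN : (r <= N)%N.
  have N0 : (0 < N)%N by rewrite card_gt0; apply/set0Pn; exists u; exact: porbit_id.
  rewrite leqNgt; apply/negP=> ltN; have := nU N.
  by rewrite expg_card_porbit uU N0 ltN => /(_ isT).
have Eorb : porbit s ((s ^+ r)%g u) = porbit s u.
  by apply/eqP; rewrite eq_porbit_mem mem_porbit.
pose s' := split_perm i s e; pose v := split_in i ((s ^+ r)%g u, 0).
have stretch j : (j <= N - r)%N -> (s' ^+ j)%g v = split_in i ((s ^+ (r + j))%g u, 0).
  move=> lej; rewrite split_perm_exp -permM -expgD big1 ?addr0 // => [[k ltk]] _ /=.
  apply/eqP; rewrite eqb0 -permM -expgD; apply/negP=> /eG[|k' ltk' E].
    exact: mem_porbit.
  suff : (r + k)%N = k' by lia.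
  by apply: expg_porbit_inj E; rewrite -/N; lia.
have defu : split_in i (u, 0) = (s' ^+ (N - r))%g v.
  by rewrite stretch // subnKC // expg_card_porbit.
have vorb : porbit s' v = cylinder (porbit s u).
  by rewrite split_porbit Eorb.
have ltN : (N - r < #|porbit s' v|)%N.
  apply: (@leq_trans N); first by rewrite ltn_subrL r0 (leq_trans r0).
  have inj0 : injective (fun x => split_in i (x, 0 : 'Z_m)) by move=> x x' /split_in_inj[].
  rewrite /N -(card_imset _ inj0); apply/subset_leq_card/subsetP=> _ /imsetP[x xu ->].
  by rewrite vorb in_cylinder.
have [|r'0 Er' nU' out] := gap_complement ltN defu (U := U').
  move=> z zv /imsetP[x xU zE]; move: zv.
  rewrite zE vorb in_cylinder /= => /porbit_index[k ltk xE].
  have [k0|k0] := posnP k.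
    by exists (N - r)%N => //; rewrite -defu xE k0 expg0 perm1.
  have lerk : (r <= k)%N.
    rewrite leqNgt; apply/negP=> ltkr; have := nU k.
    by rewrite -xE xU k0 ltkr => /(_ isT).
  exists (k - r)%N; first by rewrite leq_sub2r // ltnW.
  by rewrite stretch ?leq_sub2r ?subnKC -?xE // ltnW.
exists (#|porbit s' v| - (N - r))%N; split=> // x t xu tx.
apply: out => [|j lej]; first by rewrite vorb in_cylinder.
rewrite stretch // (inj_eq split_in_inj) xpair_eqE.
case: tx => [/negbTE->|[k /andP[k0 ltk] ->]]; first by rewrite andbF.
rewrite negb_and; apply/orP; left; apply/eqP=> E.
have [jN|jN] := eqVneq j (N - r)%N; last first.
  suff : k = (r + j)%N by lia.
  by apply: expg_porbit_inj E; rewrite -/N; lia.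
by have := nU k; rewrite E jN subnKC // expg_card_porbit uU k0 ltk => /(_ isT).
Qed.

End SplitPerm.

(** * The block-cycle incidence graph *)

Section Incidence.
Variables (m d : nat) (F : marked m d).
Implicit Types (y : base F) (l : label F) (p : 'I_(ncoord F)).

Lemma porbit_in_porbits (T : finType) (s : {perm T}) x : porbit s x \in porbits s.
Proof. exact: imset_f. Qed.

Definition cycle_label c (x : vertex F) : label F :=
  exist _ (c, porbit (fact F c) x) (porbit_in_porbits (fact F c) x).

Lemma incidence_sym p : symmetric (incidence p).
Proof. by case=> [y|l] [y'|l']. Qed.

Lemma incidence_irr p : irreflexive (incidence p).
Proof. by case. Qed.

Hypothesis consistent : forall y, cycle_consistent (fibre y).

(** By cycle-consistency, one vertex of a block decides adjacency. *)
Lemma block_in_cycleE p y l x : (ident F x).1 = y ->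
  block_in_cycle p y l = (x \in (val l).2) && (dir F (val l).1 x == p).
Proof.
move=> xy; have xB : x \in fibre y by rewrite inE xy.
have [dirB [C' C'o BC']] := consistent y (val l).1.
rewrite /block_in_cycle; congr andb.
  apply/subsetP/idP=> [|xl x' x'B]; first exact.
  case/imsetP: C'o BC' => z _ -> /subsetP BC'.
  case: l xl dirB {BC'} (BC' _ xB) (BC' _ x'B) => [[c C] /= /imsetP[z' _ ->]] /=.
  rewrite -!eq_porbit_mem => /eqP xz _ /eqP xz' /eqP x'z.
  by rewrite x'z -xz' xz.
apply/forall_inP/idP=> [->//|/eqP dx x' x'B].
by rewrite (dirB x' x) // dx.
Qed.

Lemma card_block_labels p y : factorization F -> bijective (ident F) -> (0 < #|fibre y|)%N ->
  #|[set l : label F | block_in_cycle p y l]| = multiplicity F p.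
Proof.
move=> fF bF /card_gt0P[x]; rewrite inE => /eqP xy.
rewrite -(card_dir fF x) -(card_in_imset (f := fun l : label F => (val l).1)).
  apply: eq_card => c; rewrite inE; apply/imsetP/idP=> [[l]|dc].
    by rewrite inE (block_in_cycleE _ _ xy) => /andP[_ ?] ->.
  exists (cycle_label c x) => //.
  by rewrite inE (block_in_cycleE _ _ xy) /= porbit_id.
move=> [[c C] /= Co] [[c' C'] /= C'o]; rewrite !inE !(block_in_cycleE _ _ xy) /=.
move=> /andP[xC _] /andP[xC' _] Ec; subst c'; apply: val_inj => /=; congr pair.
case/imsetP: Co xC => z _ ->; case/imsetP: C'o xC' => z' _ ->.
by rewrite -!eq_porbit_mem => /eqP <- /eqP <-.
Qed.

(** Count the edges of a component by columns and by blocks: modulo 2 this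
    gives the number of columns and b times the number of blocks. *)
Lemma component_even p b v :
    (forall l, odd #|[set y | block_in_cycle p y l]|) ->
    (forall y, #|[set l : label F | block_in_cycle p y l]| = b) ->
    ~~ odd (b * #|[set y | connect (incidence p) v (inl y)]|) ->
  ~~ odd #|[set l : label F | connect (incidence p) v (inr l)]|.
Proof.
move=> oddl degy; set K := [set y | _]; set L := [set l | _].
have KL y l : block_in_cycle p y l -> (y \in K) = (l \in L).
  move=> yl; rewrite !inE; apply: (same_connect_r (sym_connect_sym (incidence_sym p))).
  exact: connect1.
have <- : (\sum_(l in L) #|[set y | block_in_cycle p y l]| = b * #|K|)%N.
  transitivity (\sum_(y in K) \sum_(l : label F | block_in_cycle p y l) 1)%N; last first.
    under eq_bigr => y _ do rewrite sum1dep_card degy.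
    by rewrite sum_nat_const mulnC.
  rewrite (exchange_big_dep (mem L)) /=; last first.
    by move=> y l yK yl; rewrite -(KL y).
  apply: eq_bigr => l lL; rewrite -sum1dep_card; apply: eq_bigl => y.
  by case yl: (block_in_cycle p y l); rewrite ?andbF ?andbT // (KL y l).
rewrite -sum1_card !(big_morph odd oddD (erefl _)).
by apply: contra; rewrite [X in _ -> is_true X](eq_bigr (fun _ => odd 1)) // => l _; apply: oddl.
Qed.

End Incidence.

Lemma unit_odd m (N : nat) : (1 < m)%N -> ~~ odd m ->
  N%:R * N%:R = 1 :> 'Z_m -> odd N.
Proof.
move=> m1 em; rewrite -natrM => /(congr1 (@nat_of_ord _)).
rewrite val_Zp_nat // (_ : 1%R = 1%:R :> 'Z_m) // val_Zp_nat //.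
rewrite !(modn_small m1) => N2.
have : odd (N * N) by rewrite (divn_eq (N * N) m) N2 oddD oddM (negbTE em) andbF.
by rewrite oddM andbb.
Qed.

(** * The split as a factorization *)

Lemma split_inP (m n : nat) (i : 'I_n) (z : torus m n.+1) :
  exists x t, z = split_in i (x, t).
Proof.
by exists (split_out i z).1, (split_out i z).2; rewrite -surjective_pairing split_outK.
Qed.

Lemma split_dirE (m n : nat) (i : 'I_n) (g : torus m n -> 'I_n) e x t :
  split_dir i g e (split_in i (x, t)) =
    if e x then split_coord i else lift (split_coord i) (g x).
Proof. by rewrite /split_dir split_inK. Qed.

Lemma lift_neqE n (h : 'I_n.+1) j : (lift h j == h) = false.
Proof. by rewrite eq_sym (negbTE (neq_lift _ _)). Qed.

Lemma neq_liftE n (h : 'I_n.+1) j : (h == lift h j) = false.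
Proof. exact: negbTE (neq_lift _ _). Qed.

Section Split.
Variables (m d : nat) (F : marked m d) (i : 'I_(ncoord F)) (b : nat).
Variable delta : 'I_d -> torus m (ncoord F) -> bool.
Hypotheses (fF : factorization F) (spl : split_choice i b delta).

Let F' := binary_split i b delta.

Lemma split_step c (x : torus m (ncoord F)) : delta c x -> dir F c x = i.
Proof.
by case: spl => _ dir0 _ dcx; apply/eqP; apply: contraTT dcx => /dir0->.
Qed.

Lemma split_factorization : factorization F'.
Proof.
have [/andP[b0 ba] dir0 sumd] := spl; split.
- move=> p; rewrite /= /split_mult; case: unliftP => // j _.
  by case: eqP => // _; [rewrite subn_gt0 | apply: mult_gt0 fF j].
- transitivity (\sum_j multiplicity F j)%N; first exact: sum_mult.
  rewrite [RHS]/= (bigD1_ord (split_coord i)) //= [X in _ = (X + _)%N]/split_mult unlift_none.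
  rewrite (bigD1 i) //= [in RHS](bigD1 i) //= addnA; congr addn.
    by rewrite /split_mult liftK eqxx subnKC // ltnW.
  by apply: eq_bigr => j /negbTE ji; rewrite /split_mult liftK ji.
- move=> c z; have [x [t ->]] := split_inP i z; rewrite /= split_permE split_dirE (fact_step fF).
  apply/ffunP=> p; rewrite !ffunE /=; case: unliftP => [j|] ->.
    rewrite !ffunE /=; case dcx: (delta c x).
      rewrite (split_step dcx) /= lift_neqE addr0.
      by case: eqP => [_|_]; rewrite ?addr0 // opprD addrACA subrr addr0.
    by rewrite (inj_eq lift_inj) addr0; case: eqP => [->|] //; rewrite addrAC.
  by case: (delta c x); rewrite ?eqxx // neq_liftE.
- move=> z p; have [x [t ->]] := split_inP i z.
  under eq_finset => c do rewrite /= split_dirE.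
  rewrite /= /split_mult; case: unliftP => [j|] ->; last first.
    rewrite -(sumd x) -sum1dep_card [LHS]big_mkcond; apply: eq_bigr => c _.
    by case: (delta c x); rewrite ?eqxx // lift_neqE.
  have [->|ji] := eqVneq j i.
    rewrite -(card_dir fF x i) -(sumd x) -!sum1dep_card big_mkcond [in RHS]big_mkcond /=.
    rewrite -sumnB; last by move=> c _; case dcx: (delta c x); rewrite ?(split_step dcx) ?eqxx.
    apply: eq_bigr => c _; case dcx: (delta c x).
      by rewrite (split_step dcx) eqxx neq_liftE.
    by rewrite (inj_eq lift_inj) subn0.
  rewrite -(card_dir fF x j); congr #|pred_of_set _|; apply/setP=> c; rewrite !inE.
  case dcx: (delta c x); last by rewrite (inj_eq lift_inj).
  by rewrite (split_step dcx) neq_liftE eq_sym (negbTE ji).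
Qed.

Hypothesis tot : forall c (x : torus m (ncoord F)), unit_total (delta c) (porbit (fact F c) x).

(** The directions of the split depend on x only, and the cylinder over a
    cycle contains the whole fibre over each of its vertices. *)
Lemma split_consistent (x : base F') : cycle_consistent (fibre x).
Proof.
have fibP z : z \in fibre x -> exists t, z = split_in i (x, t).
  have [x' [t ->]] := split_inP i z.
  by rewrite inE [ident F' _](split_inK i) => /eqP /= <-; exists t.
move=> c; split.
  by move=> z z' /fibP[t ->] /fibP[t' ->]; rewrite /= !split_dirE.
exists (porbit (fact F' c) (split_in i (x, 0))); first exact: porbit_in_porbits.
apply/subsetP=> z /fibP[t ->] /=.
by rewrite split_porbit // in_cylinder porbit_id.
Qed.

Lemma split_porbits c C' : C' \in porbits (fact F' c) ->
  exists x : torus m (ncoord F), C' = cylinder i (porbit (fact F c) x).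
Proof.
case/imsetP=> z _ ->; have [x [t ->]] := split_inP i z; exists x.
by rewrite /= split_porbit.
Qed.

End Split.

(** * Admissibility of the split *)

(** The gap condition with the gap listed explicitly as the vertices s^k u
    for 0 < k < r. *)
Lemma gap_of_mark (m d : nat) (F : marked m d) c x :
    admissible F -> c \in distinguished F ->
    (exists2 w, w \in porbit (fact F c) x & w \in mark F) ->
  exists u r, [/\ u \in porbit (fact F c) x, (0 < r)%N,
      u \in mark F /\ (fact F c ^+ r)%g u \in mark F,
      forall k, (0 < k < r)%N -> (fact F c ^+ k)%g u \notin mark F
    & forall w, w \in porbit (fact F c) x -> (ident F w).2 != 0 ->
        exists2 k, (0 < k < r)%N & w = (fact F c ^+ k)%g u].
Proof.
move=> aF cA [w wx wU].
have [|G [u [r [uUC r0 srU nU defG]]] gapG] := adm_gap aF cA (porbit_in_porbits (fact F c) x).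
  by apply/set0Pn; exists w; rewrite inE wx.
move: uUC; rewrite inE => /andP[uU ux]; exists u, r; split=> // v vx v0.
have := gapG v vx v0; rewrite defG => /imsetP[k]; rewrite inE => k0 ->.
by exists (k : nat) => //; rewrite k0 ltn_ord.
Qed.

(** Replicating vertices does not change connectivity: paths project along h,
    and lift along h starting from any preimage. The uniqueness of the preimage
    of the target makes the lifted path end at the right vertex. *)
Lemma connect_blowup (V V' : finType) (e : rel V) (e' : rel V') (h : V' -> V) w :
    (forall a b, e' a b = e (h a) (h b)) -> (forall a, exists a', h a' = a) ->
    (forall a, h a = h w -> a = w) ->
  forall v, connect e' v w = connect e (h v) (h w).
Proof.
move=> he h_onto hw v; apply/idP/idP; last first.
  case/connectP=> p; elim: p v => [|a p IHp] v /=; first by move=> _ /esym/hw->.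
  have [a' <-] := h_onto a; rewrite -he => /andP[eva /IHp IH] /IH.
  exact: connect_trans (connect1 eva).
case/connectP=> p; elim: p v => [|a p IHp] v /=; first by move=> _ ->.
by rewrite he => /andP[eva /IHp IH] /IH; apply: connect_trans (connect1 eva).
Qed.

Section SplitAdmissible.
Variables (m d : nat) (F : marked m d) (i : 'I_(ncoord F)) (b : nat).
Local Notation X := (torus m (ncoord F)).
Variable delta : 'I_d -> X -> bool.
Hypotheses (m1 : (1 < m)%N) (m_even : ~~ odd m).
Hypotheses (aF : admissible F) (spl : split_choice i b delta).
Hypothesis tot : forall c (x : X), unit_total (delta c) (porbit (fact F c) x).
Hypothesis delta_dist :
  forall c (x : X), c \in distinguished F -> delta c x -> (ident F x).2 != 0.
(* The next two hypotheses say that the vertices of a fibre have a common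
   neighbour with one of them, in the graph of the child of multiplicity b,
   respectively of the other child. *)
Hypothesis hub1 : (2 <= b)%N -> forall y, exists2 x0 : X, (ident F x0).1 = y &
  forall x, (ident F x).1 = y -> exists c, delta c x && delta c x0.
Hypothesis hub0 : (2 <= multiplicity F i - b)%N ->
  forall y, exists2 x0 : X, (ident F x0).1 = y &
  forall x, (ident F x).1 = y -> exists c, [&& dir F c x == i, ~~ delta c x & ~~ delta c x0].

Let F' := binary_split i b delta.
Let fF := adm_fact aF.

(** The chosen vertices of a distinguished cycle have nonzero last coordinate,
    so they lie in its gap and [split_gap] applies. The last clause describes
    the lifted gap: it also contains the vertices at level 0 over the old gap,
    which the cycle count of a transport uses. *)
Lemma split_gap_of_mark c (x : X) :
    c \in distinguished F -> (exists2 w, w \in porbit (fact F c) x & w \in mark F) ->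
  exists u r r', let s := fact F c in let s' := fact F' c in let u' := split_in i (u, 0) in
    [/\ u \in porbit s x /\ (s ^+ r)%g u \in mark F,
        (0 < r')%N /\ (s' ^+ r')%g u' = split_in i ((s ^+ r)%g u, 0),
        (forall k, (0 < k < r)%N -> (s ^+ k)%g u \notin mark F) /\
          (forall k, (0 < k < r')%N -> (s' ^+ k)%g u' \notin mark F'),
        u \in mark F /\ (forall w, w \in porbit s x -> delta c w ->
          exists2 k, (0 < k < r)%N & w = (s ^+ k)%g u)
      & forall w t, w \in porbit s x ->
          t != 0 \/ (exists2 k, (0 < k < r)%N & w = (s ^+ k)%g u) ->
          exists2 k, (0 < k < r')%N & split_in i (w, t) = (s' ^+ k)%g u'].
Proof.
move=> cA /(gap_of_mark aF cA)[u [r [ux r0 [uU srU] nU gapU]]].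
have Eux : porbit (fact F c) u = porbit (fact F c) x by apply/eqP; rewrite eq_porbit_mem.
have gapD w : w \in porbit (fact F c) x -> delta c w ->
    exists2 k, (0 < k < r)%N & w = (fact F c ^+ k)%g u.
  by move=> wx dw; apply: gapU wx _; apply: delta_dist dw.
have [|r' [r'0 sr' nU' out]] := @split_gap _ _ i _ (delta c) _ _ _ r0 uU srU nU _ (tot c u).
  by rewrite Eux.
by exists u, r, r'; split=> // w t wx; apply: out; rewrite Eux.
Qed.

(** A union of fibres has a cardinality divisible by the even number m. *)
Lemma even_saturated (W : {set X}) :
  (forall x x', (ident F x).1 = (ident F x').1 -> (x \in W) = (x' \in W)) -> ~~ odd #|W|.
Proof.
have [g gK Kg] := adm_ident aF; move=> Wsat; pose Y := [set y | g (y, 0) \in W].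
rewrite -(card_imset _ (can_inj gK)) (_ : _ @: _ = setX Y setT).
  by rewrite cardsX cardsT card_ord Zp_cast // oddM (negbTE m_even) andbF.
apply/setP=> -[y t]; rewrite in_setX in_setT andbT inE.
rewrite (Wsat _ (g (y, t))); last by rewrite !Kg.
by rewrite -{1}[(y, t)]Kg mem_imset //; apply: can_inj gK.
Qed.

Lemma cylinder_porbits (l : label F) :
  cylinder i (val l).2 \in porbits (fact F' (val l).1).
Proof.
case: l => [[c C] /= /imsetP[x _ ->]].
by have := porbit_in_porbits (fact F' c) (split_in i (x, 0)); rewrite /= split_porbit.
Qed.

Definition cylinder_label (l : label F) : label F' :=
  exist _ ((val l).1, cylinder i (val l).2) (cylinder_porbits l).

Lemma cylinder_inj n (j : 'I_n) : injective (@cylinder m n j).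
Proof. by move=> C D E; apply/setP=> x; rewrite -!(in_cylinder j _ _ 0) E. Qed.

Lemma cylinder_label_inj : injective cylinder_label.
Proof.
move=> l l' /(congr1 val)[E1 /cylinder_inj E2]; apply: val_inj.
by rewrite [val l]surjective_pairing [val l']surjective_pairing /= E1 E2.
Qed.

Lemma cylinder_label_onto l' : exists l, l' = cylinder_label l.
Proof.
case: l' => [[c C'] C'o]; have [x E] := split_porbits tot C'o.
by exists (cycle_label c x); apply: val_inj; rewrite /= -E.
Qed.

Lemma cylinder_adjacent p (x : base F') l :
  block_in_cycle p x (cylinder_label l) = (x \in (val l).2) &&
    ((if delta (val l).1 x then split_coord i
      else lift (split_coord i) (dir F (val l).1 x)) == p).
Proof.
rewrite (@block_in_cycleE _ _ F' (split_consistent tot) _ _ _ (split_in i (x, 0))).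
  by rewrite /= in_cylinder split_dirE.
by rewrite [ident F' _](split_inK i).
Qed.


Lemma same_fibre_porbit c (x x' : X) :
  (ident F x).1 = (ident F x').1 -> x' \in porbit (fact F c) x.
Proof.
move=> xx'; have [_ [C /imsetP[z _ ->] /subsetP BC]] := adm_fibre aF (ident F x).1 c.
have := BC x; have := BC x'; rewrite !inE xx' eqxx => /(_ isT) + /(_ isT).
by rewrite -!eq_porbit_mem => /eqP-> /eqP->.
Qed.

Lemma same_fibre_dir c (x x' : X) :
  (ident F x).1 = (ident F x').1 -> dir F c x = dir F c x'.
Proof.
move=> xx'; have [dirB _] := adm_fibre aF (ident F x).1 c.
by apply: dirB; rewrite inE ?xx'.
Qed.

Lemma odd_split_degree c (x : X) : odd #|[set w in porbit (fact F c) x | delta c w]|.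
Proof.
apply: (unit_odd m1 m_even); have := tot c x; rewrite /unit_total /=.
suff -> : (\sum_(w in porbit (fact F c) x) delta c w)%N =
   #|[set w in porbit (fact F c) x | delta c w]| by [].
by rewrite -sum1dep_card [RHS]big_mkcondr; apply: eq_bigr => w _; case: (delta c w).
Qed.

(** The vertices of a cycle that use direction i form a union of fibres, so
    there are evenly many of them, oddly many of which are chosen. *)
Lemma odd_unsplit_degree c (x : X) :
  odd #|[set w in porbit (fact F c) x | (dir F c w == i) && ~~ delta c w]|.
Proof.
have := odd_split_degree c x.
have : ~~ odd #|[set w in porbit (fact F c) x | dir F c w == i]|.
  apply: even_saturated => w w' ww'; rewrite !inE (same_fibre_dir c ww').
  congr andb; rewrite -!eq_porbit_mem; congr (_ == _); apply/eqP.
  by rewrite eq_porbit_mem (same_fibre_porbit c (esym ww')).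
rewrite -(cardsID [set w | delta c w]) oddD.
rewrite (_ : _ :&: _ = [set w in porbit (fact F c) x | delta c w]).
  rewrite (_ : _ :\: _ = [set w in porbit (fact F c) x | (dir F c w == i) && ~~ delta c w]).
    by case: (odd _); case: (odd _).
  by apply/setP=> w; rewrite !inE [RHS]andbA andbC.
apply/setP=> w; rewrite !inE -andbA; congr andb.
by case dw: (delta c w); rewrite ?andbF // (split_step spl dw) eqxx.
Qed.

(** Here Q tells which colours use the child p of i at a vertex. All the blocks
    over an old fibre lie in one component by the last hypothesis, so that a
    component has evenly many blocks. *)
Lemma split_even_child (p : 'I_(ncoord F')) (Q : 'I_d -> X -> bool) v :
    (forall x l, block_in_cycle p x (cylinder_label l) = (x \in (val l).2) && Q (val l).1 x) ->
    (forall c (x : X), odd #|[set w in porbit (fact F c) x | Q c w]|) ->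
    (forall y, exists2 x0 : X, (ident F x0).1 = y &
       forall x, (ident F x).1 = y -> exists c, Q c x && Q c x0) ->
  ~~ odd #|[set l : label F' | connect (incidence p) v (inr l)]|.
Proof.
move=> adjQ oddQ hubQ.
have fibre0 y : (0 < #|fibre (F := F') y|)%N.
  apply/card_gt0P; exists (split_in i (y, 0)).
  by rewrite inE [ident F' _](split_inK i).
apply: (@component_even _ _ F' p (multiplicity F' p)) => [l'|y|].
- have [l ->] := cylinder_label_onto l'; case: l => [[c C] Co].
  have /imsetP[x _ /= Ex] := Co; have := oddQ c x; congr (is_true (odd _)).
  by apply: eq_card => w; rewrite !inE adjQ /= Ex.
- apply: card_block_labels => //.
  + exact: split_consistent.
  + exact: split_factorization.
  + by exists (split_in i); [apply: split_outK | apply: split_inK].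
rewrite oddM negb_and; apply/orP; right; apply: even_saturated.
have eC := sym_connect_sym (@incidence_sym _ _ F' p).
have hub_conn y : exists x0 : X, forall x, (ident F x).1 = y ->
    connect (@incidence _ _ F' p) v (inl x) = connect (@incidence _ _ F' p) v (inl x0).
  have [x0 Ex0 hub] := hubQ y; exists x0 => x Ex; have [c /andP[Qx Qx0]] := hub x Ex.
  apply: (same_connect_r eC).
  apply: (@connect_trans _ _ (inr (cylinder_label (cycle_label c x)))); apply: connect1 => /=.
    by rewrite adjQ /= porbit_id Qx.
  by rewrite adjQ /= Qx0 same_fibre_porbit // Ex Ex0.
move=> x x' xx'; have [x0 conn] := hub_conn (ident F x').1.
by rewrite !inE !conn.
Qed.

(** The new graph of j is the old one with each block replicated m times,
    since the choices do not affect direction j. *)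
Lemma split_even_other (j : 'I_(ncoord F)) v : j != i -> (2 <= multiplicity F j)%N ->
  ~~ odd #|[set l | connect (@incidence _ _ F' (lift (split_coord i) j)) v (inr l)]|.
Proof.
move=> ji j2; have [g cylK] := fin_all_exists cylinder_label_onto.
have gK l : g (cylinder_label l) = l by apply: cylinder_label_inj.
pose h (w : base F' + label F') : base F + label F :=
  match w with inl x => inl (ident F x).1 | inr l' => inr (g l') end.
have hinc a a' : @incidence _ _ F' (lift (split_coord i) j) a a' = incidence j (h a) (h a').
  suff E x l' : @block_in_cycle _ _ F' (lift (split_coord i) j) x l' =
      block_in_cycle j (ident F x).1 (g l').
    by case: a => [x|l]; case: a' => [x'|l'] //=; rewrite E.
  rewrite {1}(cylK l') cylinder_adjacent (block_in_cycleE (adm_fibre aF) j _ (erefl (ident F x).1)).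
  congr andb; case dx: (delta _ x); last by rewrite (inj_eq lift_inj).
  by rewrite neq_liftE (split_step spl dx) eq_sym (negbTE ji).
have h_onto a : exists a', h a' = a.
  case: a => [y|l]; last by exists (inr (cylinder_label l)); rewrite /= gK.
  have [f fK Kf] := adm_ident aF; exists (inl (f (y, 0))); by rewrite /= Kf.
have hr l' a : h a = h (inr l') -> a = inr l'.
  by case: a => //= l [E]; rewrite (cylK l) (cylK l') E.
have := adm_even aF j2 (h v); congr (~~ odd _).
rewrite -(card_imset _ cylinder_label_inj); apply: eq_card => l'.
rewrite [l']cylK mem_imset ?inE; last exact: cylinder_label_inj.
by rewrite (connect_blowup hinc h_onto (@hr _)) /= gK.
Qed.

Lemma split_admissible : admissible F'.
Proof.
have fib0 x : ident F' (split_in i (x, 0)) = (x, 0) by apply: split_inK.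
split.
- exact: split_factorization.
- by exists (split_in i); [apply: split_outK | apply: split_inK].
- exact: split_consistent.
- move=> z p; have [x [t ->]] := split_inP i z.
  (* All the colours in a child of i use i, and those in another direction
     of the split use the same direction before. *)
  have [q le_q] : exists q, [set c in distinguished F' | dir F' c (split_in i (x, t)) == p]
      \subset [set c in distinguished F | dir F c x == q].
    case: (unliftP (split_coord i) p) => [j|] ->; [exists j | exists i];
      apply/subsetP=> c; rewrite !inE /= split_dirE => /andP[->] /=.
      by case: ifP => _; rewrite ?neq_liftE // (inj_eq lift_inj).
    by case: ifP => [/(split_step spl)->//|_]; rewrite lift_neqE.
  exact: leq_trans (subset_leq_card le_q) (adm_dist aF x q).
- by move=> z /imsetP[x _ ->]; rewrite fib0.
- move=> c C' cA /(split_porbits tot)[x ->] /set0Pn[z /setIP[zC /imsetP[w wU zw]]].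
  rewrite zw in_cylinder in zC.
  have [|u [r [r' [[ux srU] [r'0 Er'] [_ nU'] [uU _] out]]]] := @split_gap_of_mark c x cA.
    by exists w.
  exists [set (fact F' c ^+ (k : nat))%g (split_in i (u, 0)) | k : 'I_r' & (0 < k)%N].
    exists (split_in i (u, 0)), r'; split=> //.
      by rewrite inE in_cylinder ux andbT; apply/imsetP; exists u.
    by rewrite Er'; apply/imsetP; eexists; [exact: srU | ].
  move=> y; have [x' [t ->]] := split_inP i y; rewrite in_cylinder => x'x.
  rewrite [ident F' _](split_inK i) /= => t0.
  have [|k /andP[k0 ltk] ->] := out x' t x'x; first by left.
  by apply/imsetP; exists (Ordinal ltk); rewrite ?inE.
move=> p; case: (unliftP (split_coord i) p) => [j|] -> p2 v.
  have [ji|ji] := eqVneq j i; last first.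
    apply: split_even_other => //.
    by move: p2; rewrite /= /split_mult liftK (negbTE ji).
  rewrite ji in p2 *; apply: (split_even_child (Q := fun c x => (dir F c x == i) && ~~ delta c x)).
  - move=> x l; rewrite cylinder_adjacent; congr andb; case: ifP => [_|_].
      by rewrite neq_liftE andbF.
    by rewrite (inj_eq lift_inj) andbT.
  - exact: odd_unsplit_degree.
  move=> y; have [|x0 Ex0 hub] := hub0 _ y.
    by move: p2; rewrite /= /split_mult liftK eqxx.
  exists x0 => // x Ex; have [c /and3P[dx nx nx0]] := hub x Ex; exists c.
  by rewrite dx nx nx0 -(same_fibre_dir c (x := x)) ?Ex // dx.
apply: (split_even_child (Q := delta)).
- move=> x l; rewrite cylinder_adjacent; congr andb; case: ifP => [_|_].
    by rewrite eqxx.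
  by rewrite lift_neqE.
- exact: odd_split_degree.
by move=> y; apply: hub1; move: p2; rewrite /= /split_mult unlift_none.
Qed.

End SplitAdmissible.

(** * Transport of a recolouring *)

Section Transport.
Variables (m d : nat) (F : marked m d) (i : 'I_(ncoord F)) (b : nat).
Local Notation X := (torus m (ncoord F)).
Variable delta : 'I_d -> X -> bool.
Hypotheses (aF : admissible F).
Hypothesis tot : forall c (x : X), unit_total (delta c) (porbit (fact F c) x).
Hypothesis delta_dist :
  forall c (x : X), c \in distinguished F -> delta c x -> (ident F x).2 != 0.
Variables (sigma : X -> {perm 'I_d}) (S' : 'I_d -> {perm X}).
Hypothesis rec : recolouring sigma S'.

Let F' := binary_split i b delta.

Lemma delta_mark c (x : X) : c \in distinguished F -> x \in mark F -> delta c x = false.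
Proof.
move=> cA xU; apply/negP=> /(delta_dist cA).
by rewrite (adm_mark aF xU) eqxx.
Qed.

Definition transported c (z : vertex F') : vertex F' :=
  if (z \in mark F') && (c \in distinguished F) then fact F' (transport i sigma z c) z
  else fact F' c z.

Lemma in_split_mark x t : (split_in i (x, t) \in mark F') = (x \in mark F) && (t == 0).
Proof.
apply/imsetP/andP=> [[w wU /split_in_inj[-> ->]]|[xU /eqP->]]; first by rewrite eqxx.
by exists x.
Qed.

(** At marks of level 0 the transport acts as the recolouring does. At marks
    of the other levels it still follows the original permutation, so the
    transport is not a split of the recolouring; off the marks the two
    permutations agree. *)
Lemma transportedE c x t : transported c (split_in i (x, t)) =
  split_in i (if [&& x \in mark F, c \in distinguished F & t != 0] then fact F c x else S' c x,
              t + (delta c x)%:R).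
Proof.
have [sA S'E] := rec; rewrite /transported in_split_mark S'E.
case xU: (x \in mark F) => /=; last by rewrite split_permE.
case cA: (c \in distinguished F); last by rewrite andbF split_permE.
case: eqP => [->|_] /=; last by rewrite split_permE.
rewrite /transport split_inK eqxx split_permE !delta_mark // perm_closed //.
exact: sA.
Qed.

(** Two preimages can only differ if one of them is a mark at nonzero level
    and the other one is not. The recoloured step then comes from a mark of
    level 0, and the levels distinguish the images because no distinguished
    colour is chosen at a mark. *)
Lemma transported_inj c : injective (transported c).
Proof.
move=> z z'; have [x [t ->]] := split_inP i z; have [x' [t' ->]] := split_inP i z'.
rewrite !transportedE => /split_in_inj/pair_equal_spec[].
have [sA S'E] := rec.
suff main : forall (x : X) (t : 'Z_m) (x' : X) (t' : 'Z_m),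
    [&& x \in mark F, c \in distinguished F & t != 0] ->
    fact F c x = S' c x' -> t + (delta c x)%:R = t' + (delta c x')%:R ->
    [&& x' \in mark F, c \in distinguished F & t' != 0].
  case: ifP => h; case: ifP => h' E1 E2.
  - by move: E2; rewrite (perm_inj E1) => /addIr->.
  - by rewrite (main _ _ _ _ h E1 E2) in h'.
  - by rewrite (main _ _ _ _ h' (esym E1) (esym E2)) in h.
  - by move: E2; rewrite (perm_inj E1) => /addIr->.
move=> {}x {}t {}x' {}t' /and3P[xU cA t0] E1 E2; rewrite cA /=.
case x'U: (x' \in mark F); last first.
  by move: E1; rewrite S'E x'U /= => /perm_inj E; rewrite -E xU in x'U.
by move: E2; rewrite !delta_mark // !addr0 => <-.
Qed.

Definition transported_perm c : {perm vertex F'} := perm (@transported_inj c).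

Lemma transport_recolouring :
  @recolouring m d F' (transport i sigma) transported_perm.
Proof.
have [sA _] := rec; split=> [z /imsetP[x xU ->]|c z]; last by rewrite permE.
by rewrite /transport split_inK eqxx; apply: sA.
Qed.

Section Count.
Variable c : 'I_d.
Local Notation s := (fact F c).
Local Notation s1 := (S' c).
Local Notation hat := (fact F' c).
Local Notation hat1 := (transported_perm c).

(** The cycles that a recolouring of c may affect. *)
Let hit (x : X) := (c \in distinguished F) && [exists w in mark F, w \in porbit s x].

Lemma recoloured_off (x : X) : ~~ ((x \in mark F) && (c \in distinguished F)) -> s1 x = s x.
Proof. by have [_ ->] := rec; move/negbTE->. Qed.

Lemma transported_off z : z \notin mark F' -> hat1 z = hat z.
Proof. by rewrite permE /transported => /negbTE->. Qed.

(** If c is distinguished, no mark lies over such a cycle, so that the transport follows the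
    split there, whose lifted cycle is the whole cylinder. *)
Lemma unhit_cycle (x : X) t t' y : ~~ hit x -> y \in porbit s x ->
  split_in i (y, t') \in porbit hat1 (split_in i (x, t)).
Proof.
move=> nhit yx; have : split_in i (y, t') \in porbit hat (split_in i (x, t)).
  by rewrite /= split_porbit // in_cylinder.
case/porbitP=> k ->; rewrite -(@expg_agree _ hat hat1 [set z in mark F' | c \in distinguished F]).
- exact: mem_porbit.
- by move=> z; rewrite inE permE /transported => /negbTE->.
move=> j _; rewrite inE split_perm_exp in_split_mark; apply: contra nhit.
case/andP=> /andP[wU _] cA; rewrite /hit cA; apply/exists_inP; eexists; first exact: wU.
exact: mem_porbit.
Qed.

(** The end v of the gap: neither recolouring changes the steps inside a gap,
    so v is reached from all of the old gap, and (v, 0) from all of the lifted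
    gap, which contains every vertex of nonzero level. *)
Lemma hit_hub (x : X) : hit x -> exists v : X, forall w, w \in porbit s x ->
  [/\ delta c w -> v \in porbit s1 w /\ v \in porbit s1 (s w),
      forall t, t != 0 \/ delta c w -> split_in i (v, 0) \in porbit hat1 (split_in i (w, t))
    & delta c w -> split_in i (v, 0) \in porbit hat1 (split_in i (s w, 0))].
Proof.
case/andP=> cA /exists_inP[w0 w0U w0x].
have [|u [r [r' [[ux srU] [r'0 Er'] [nU nU'] [uU gapD] out]]]] :=
  @split_gap_of_mark m d F i b delta aF tot delta_dist c x cA.
  by exists w0.
pose v := (s ^+ r)%g u; exists v.
have old_end k : (0 < k <= r)%N -> v \in porbit s1 ((s ^+ k)%g u).
  move=> /andP[k0 lek]; have -> : v = (s1 ^+ (r - k))%g ((s ^+ k)%g u).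
    rewrite (@expg_agree _ s s1 (mark F)) -?permM -?expgD ?subnKC //.
      by move=> y yU; apply: recoloured_off; rewrite (negbTE yU).
    move=> j ltj; rewrite -permM -expgD; apply: nU.
    by rewrite addn_gt0 k0 /= -ltn_subRL.
  exact: mem_porbit.
have new_end w t : w \in porbit s x -> t != 0 \/ (exists2 k, (0 < k < r)%N & w = (s ^+ k)%g u) ->
    split_in i (v, 0) \in porbit hat1 (split_in i (w, t)).
  move=> wx wt; have [k /andP[k0 ltk] ->] := out w t wx wt.
  have -> : split_in i (v, 0) = (hat1 ^+ (r' - k))%g ((hat ^+ k)%g (split_in i (u, 0))).
    rewrite (@expg_agree _ hat hat1 (mark F')) -?permM -?expgD ?subnKC ?Er' // 1?ltnW //.
      exact: transported_off.
    move=> j ltj; rewrite -permM -expgD; apply: nU'.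
    by rewrite addn_gt0 k0 /= -ltn_subRL.
  exact: mem_porbit.
move=> w wx; split=> [dw|t|dw].
- have [k /andP[k0 ltk] ->] := gapD w wx dw; split.
    by apply: old_end; rewrite k0 ltnW.
  by rewrite -permM -expgSr; apply: old_end.
- by case=> [t0|dw]; apply: new_end => //; [left | right; apply: gapD].
have [k /andP[k0 ltk] wE] := gapD w wx dw.
have sw : s w = (s ^+ k.+1)%g u by rewrite wE -permM -expgSr.
have [kr|kr] := eqVneq k.+1 r; first by rewrite sw kr porbit_id.
apply: new_end; last by right; exists k.+1 => //=; rewrite ltn_neqAle kr.
by rewrite -eq_porbit_mem porbit_succ eq_porbit_mem.
Qed.

(** The maps x |-> (x, 0) and h carry cycles to cycles in both directions,
    where h keeps x at level 0 or on an unaffected cycle, and otherwise sends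
    (x, t) to the end of the gap of the cycle of x. *)
Lemma card_porbits_transported : #|porbits hat1| = #|porbits s1|.
Proof.
(* The end of the gap is chosen for each cycle C and not for each x, so that
   h is constant along the lifted gap. *)
have hubs (C : {set X}) : exists v : X, forall x : X, C = porbit s x -> hit x ->
  forall w, w \in C ->
  [/\ delta c w -> v \in porbit s1 w /\ v \in porbit s1 (s w),
      forall t, t != 0 \/ delta c w -> split_in i (v, 0) \in porbit hat1 (split_in i (w, t))
    & delta c w -> split_in i (v, 0) \in porbit hat1 (split_in i (s w, 0))].
  have [/existsP[x /andP[/eqP-> hx]]|] := boolP [exists x : X, (C == porbit s x) && hit x].
    by have [v vP] := hit_hub hx; exists v.
  move=> no; exists 0 => x Cx hx; case/negP: no.
  by apply/existsP; exists x; rewrite Cx eqxx hx.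
have [hub hubP] := fin_all_exists hubs.
have hub_of (x : X) : hit x -> forall w, w \in porbit s x -> _ := hubP (porbit s x) x erefl.
have hit_step (x : X) : hit (s x) = hit x by rewrite /hit porbit_succ.
have s1E (x : X) : ~~ hit x -> s1 x = s x.
  move=> nhit; apply: recoloured_off; apply: contra nhit => /andP[xU cA].
  by rewrite /hit cA; apply/exists_inP; exists x; rewrite ?porbit_id.
have hat1E (x : X) t := etrans (permE (@transported_inj c) _) (transportedE c x t).
apply/eqP; rewrite eqn_leq; apply/andP; split.
  apply: (leq_card_porbits (h := fun x : X => split_in i (x, 0))) => [x|z].
    case dx: (delta c x); last first.
      by have := porbit_step hat1 (split_in i (x, 0)); rewrite hat1E eqxx !andbF dx addr0.
    have [hx|nhx] := boolP (hit x); last first.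
      by rewrite s1E //; apply: unhit_cycle nhx _; apply: porbit_step.
    rewrite recoloured_off; last first.
      by apply/negP=> /andP[xU cA]; rewrite delta_mark in dx.
    have [_ nx nsx] := hub_of x hx x (porbit_id _ _).
    have := nx 0 (or_intror dx); have := nsx dx.
    by rewrite -!eq_porbit_mem => /eqP-> /eqP->.
  have [x [t ->]] := split_inP i z.
  have [hx|nhx] := boolP (hit x); last by exists x; apply: unhit_cycle nhx _; apply: porbit_id.
  have [_ nx _] := hub_of x hx x (porbit_id _ _).
  have [->|t0] := eqVneq t 0; first by exists x; apply: porbit_id.
  by exists (hub (porbit s x)); apply: nx; left.
pose h z := let: (x, t) := split_out i z in if (t == 0) || ~~ hit x then x else hub (porbit s x).
have hE x t : h (split_in i (x, t)) = if (t == 0) || ~~ hit x then x else hub (porbit s x).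
  by rewrite /h split_inK.
apply: (leq_card_porbits (h := h)) => [z|x]; last first.
  by exists (split_in i (x, 0)); rewrite hE eqxx porbit_id.
have [x [t ->]] := split_inP i z; rewrite hat1E !hE.
have [/and3P[xU cA t0]|/negbTE xUt] := boolP [&& x \in mark F, c \in distinguished F & t != 0].
  have hx : hit x by rewrite /hit cA; apply/exists_inP; exists x; rewrite ?porbit_id.
  by rewrite /= delta_mark // addr0 (negbTE t0) hit_step hx porbit_succ porbit_id.
have s1x : t = 0 /\ delta c x = false \/ s1 x = s x.
  have [xUA|] := boolP ((x \in mark F) && (c \in distinguished F)); last first.
    by move=> nxUA; right; apply: recoloured_off.
  left; move: xUt; rewrite andbA xUA => /negbFE/eqP->; split=> //.
  by case/andP: xUA => xU cA; apply: delta_mark.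
case: s1x => [[-> ->]|sx].
  by rewrite addr0 eqxx porbit_step.
have step : s x \in porbit s1 x by rewrite -sx porbit_step.
rewrite sx hit_step porbit_succ; have [hx|nhx] := boolP (hit x); last by rewrite !orbT.
rewrite !orbF; have [dx _ _] := hub_of x hx x (porbit_id _ _).
case dcx: (delta c x) dx => dx; last first.
  by rewrite addr0; case: eqP; rewrite ?porbit_id.
have [hx1 hx2] := dx erefl.
have [->|t0] := eqVneq t 0; first by rewrite add0r oner_eq0.
case: eqP => _; last exact: porbit_id.
by rewrite -eq_porbit_mem eq_sym eq_porbit_mem.
Qed.

End Count.
End Transport.

(** * Existence of a good choice of split arcs *)

Section Choice.
Variables (m d : nat) (F : marked m d) (i : 'I_(ncoord F)).
Local Notation X := (torus m (ncoord F)).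
Hypothesis m3 : (3 <= m)%N.
Hypotheses (aF : admissible F) (i2 : (2 <= multiplicity F i)%N).

Lemma cycle_label_eq c (x x' : X) :
  x' \in porbit (fact F c) x -> cycle_label c x' = cycle_label c x.
Proof.
by rewrite -eq_porbit_mem => /eqP E; apply: val_inj; rewrite /= E.
Qed.

(** The flow of [unit_flow] for the set of cycle columns, restricted to the
    edges from blocks to columns. *)
Lemma incidence_flow : exists f : base F -> label F -> int,
  [/\ forall y l, `|f y l| <= (block_in_cycle i y l)%:R,
      forall y, \sum_l f y l = 0
    & forall l, (\sum_y f y l) * (\sum_y f y l) = 1].
Proof.
pose T : {set base F + label F} := [set inr l | l in [set: label F]].
have inrI : injective (@inr (base F) (label F)) by move=> l l' [].
have evT v : ~~ odd #|[set w in T | connect (incidence i) v w]|.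
  have := adm_even aF i2 v; congr (~~ odd _).
  rewrite -(card_imset _ inrI); apply: eq_card => w; rewrite !inE.
  apply/imsetP/andP=> [[l] | [/imsetP[l _ ->] conn]]; last by exists l; rewrite ?inE.
  by rewrite inE => conn ->; split=> //; apply: imset_f.
have [f [fA fe fx]] := unit_flow (@incidence_sym _ _ F i) (@incidence_irr _ _ F i) evT.
exists (fun y l => f (inl y) (inr l)); split=> [y l|y|l]; first exact: fe.
  have := fx (inl y); rewrite (_ : inl y \in T = false); last first.
    by apply/imsetP=> -[].
  rewrite /excess big_sumType /= big1 ?add0r; first by move=> /eqP; rewrite normr_eq0 => /eqP.
  by move=> y' _; apply/eqP; rewrite -normr_le0; apply: fe.
have := fx (inr l); rewrite imset_f // /excess big_sumType /= [X in _ + X]big1 ?addr0; last first.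
  by move=> l' _; apply/eqP; rewrite -normr_le0; apply: fe.
under eq_bigr => y _ do rewrite fA.
rewrite sumrN normrN => n1; rewrite -expr2 -[LHS]ger0_norm ?sqr_ge0 // normrX n1.
by rewrite expr1n.
Qed.

(** Apply [block_pattern] in each block y to the values of the flow. The total
    of a cycle is then the excess of its column, up to sign, modulo m. *)
Lemma split_choice_exists : exists delta : 'I_d -> X -> bool,
  [/\ split_choice i (multiplicity F i)./2 delta,
      forall c (x : X), unit_total (delta c) (porbit (fact F c) x),
      forall c (x : X), c \in distinguished F -> delta c x -> (ident F x).2 != 0,
      (2 <= (multiplicity F i)./2)%N -> forall y, exists2 x0 : X, (ident F x0).1 = y &
        forall x, (ident F x).1 = y -> exists c, delta c x && delta c x0
    & (2 <= multiplicity F i - (multiplicity F i)./2)%N ->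
        forall y, exists2 x0 : X, (ident F x0).1 = y &
        forall x, (ident F x).1 = y ->
          exists c, [&& dir F c x == i, ~~ delta c x & ~~ delta c x0]].
Proof.
have fF := adm_fact aF; have [g gK Kg] := adm_ident aF.
have [f [fe f0 f1]] := incidence_flow.
pose x_ y : X := g (y, 0); have xK y : (ident F (x_ y)).1 = y by rewrite Kg.
pose E y := [set c | dir F c (x_ y) == i].
pose fy y c := f y (cycle_label c (x_ y)).
have cE y : #|E y| = multiplicity F i by apply: card_dir.
have dirE c x y : (ident F x).1 = y -> (dir F c x == i) = (c \in E y).
  by move=> Ey; rewrite inE (same_fibre_dir aF c (x' := x_ y)) ?xK.
have adj y l x : (ident F x).1 = y ->
    block_in_cycle i y l = (x \in (val l).2) && (dir F (val l).1 x == i).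
  by move=> Ey; apply: (block_in_cycleE (adm_fibre aF) i _ Ey).
have fy_le y c : `|fy y c| <= (c \in E y)%:R.
  by have := fe y (cycle_label c (x_ y)); rewrite (adj _ _ _ (xK y)) /= porbit_id inE.
have fy_sum y : \sum_c fy y c = 0.
  rewrite -[RHS](f0 y) (bigID (mem [set cycle_label c (x_ y) | c in 'I_d])) /=.
  rewrite [X in _ + X]big1 ?addr0; last first.
    move=> l; have := fe y l; rewrite (adj _ _ _ (xK y)).
    case: andP => [[xl dl] _|_]; last by rewrite normr_le0 => /eqP.
    case/imsetP; exists (val l).1 => //; apply: val_inj => /=.
    case: l xl {dl} => [[c C] /= /imsetP[z _ ->]].
    by rewrite -eq_porbit_mem => /eqP->.
  by rewrite big_imset //= => c c' _ _ /(congr1 val)[].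
have EA y : (#|E y :&: distinguished F| <= 1)%N.
  apply: leq_trans (adm_dist aF (x_ y) i); apply: subset_leq_card.
  by apply/subsetP=> c; rewrite !inE andbC.
have pattern y := @block_pattern m 'I_d (E y) (distinguished F) (fy y) m3.
have /fin_all_exists[D DP] := fun y => pattern y (EA y) (fy_le y) (fy_sum y).
pose delta c (x : X) := c \in D (ident F x).1 (ident F x).2.
exists delta; split.
- split=> [|c x|x].
  + by clear -i2; lia.
  + have [DE _ _ _ _] := DP (ident F x).1.
    by rewrite (dirE _ _ _ erefl) /delta; apply: contraNF; apply: (subsetP (DE _)).
  have [_ cD _ _ _] := DP (ident F x).1; rewrite cE in cD.
  rewrite -(cD (ident F x).2) -sum1_card [RHS]big_mkcond /=.
  by apply: eq_bigr => c _; rewrite /delta; case: (c \in _).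
- move=> c x; rewrite /unit_total /=.
  suff -> : (\sum_(w in porbit (fact F c) x) delta c w)%:R =
      (\sum_y f y (cycle_label c x))%:~R :> 'Z_m by rewrite -rmorphM f1.
  rewrite natr_sum rmorph_sum /= (reindex g) /=; last by exists (ident F) => ? _.
  have gorb y t : (g (y, t) \in porbit (fact F c) x) = (x_ y \in porbit (fact F c) x).
    rewrite -!eq_porbit_mem; congr (_ == _); apply/eqP.
    by rewrite eq_porbit_mem (same_fibre_porbit aF) // !Kg.
  transitivity (\sum_y \sum_t
      if g (y, t) \in porbit (fact F c) x then (delta c (g (y, t)))%:R else 0 : 'Z_m).
    by rewrite pair_bigA big_mkcond; apply: eq_bigr => -[y t].
  apply: eq_bigr => y _; have [_ _ _ cD _] := DP y.
  have [xy|xy] := boolP (x_ y \in porbit (fact F c) x).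
    rewrite -(cycle_label_eq xy) -/(fy y c) -cD natr_sum.
    by apply: eq_bigr => t _; rewrite gorb xy /delta Kg.
  rewrite big1 => [|t _]; last by rewrite gorb (negbTE xy).
  have := fe y (cycle_label c x); rewrite (adj _ _ _ (xK y)) /= (negbTE xy) /=.
  by rewrite normr_le0 => /eqP->.
- move=> c x cA; have [_ _ D0 _ _] := DP (ident F x).1.
  by rewrite /delta; apply: contraTneq => ->; rewrite (disjointFl D0).
- move=> b2 y; have [_ _ _ _ [t0 Dt]] := DP y; exists (g (y, t0)); first by rewrite Kg.
  move=> x Ex; have [+ _] := Dt (ident F x).2; rewrite cE => /(_ b2)/set0Pn[c].
  by rewrite inE => cc; exists c; rewrite /delta Kg Ex.
move=> b2 y; have [_ _ _ _ [t0 Dt]] := DP y; exists (g (y, t0)); first by rewrite Kg.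
move=> x Ex; have [_ +] := Dt (ident F x).2; rewrite cE => /(_ b2)/set0Pn[c].
rewrite in_setI !in_setD => /andP[/andP[n1 cEy] /andP[n2 _]]; exists c.
by rewrite (dirE _ _ _ Ex) /delta Kg Ex cEy n1 n2.
Qed.

End Choice.

(** * Successive splits *)

Lemma good_split_exists (m d : nat) (F : marked m d) (i : 'I_(ncoord F)) :
    (3 <= m)%N -> ~~ odd m -> admissible F -> (2 <= multiplicity F i)%N ->
  exists delta : 'I_d -> torus m (ncoord F) -> bool, good_split i delta.
Proof.
move=> m3 em aF i2.
have [delta [spl tot dist hub1 hub0]] := split_choice_exists m3 aF i2.
exists delta; split=> // [|sigma S' rec].
  exact: (split_admissible (ltnW m3) em aF spl tot dist hub1 hub0).
exists (transported_perm i (multiplicity F i)./2 aF dist rec); first exact: transport_recolouring.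
by move=> c; apply: card_porbits_transported.
Qed.

Section Sequences.
Variables m d : nat.
Implicit Types F : marked m d.

Lemma ncoord_le F : admissible F -> (ncoord F <= d)%N.
Proof.
move=> aF; rewrite [X in (_ <= X)%N](sum_mult (adm_fact aF)) -[X in (X <= _)%N]card_ord -sum1_card.
by apply: leq_sum => i _; apply: mult_gt0 (adm_fact aF) i.
Qed.

Lemma ncoord_split_end F (q : split_seq F) : ncoord (split_end q) = (ncoord F + split_size q)%N.
Proof. by elim: q => [G|G i delta i2 good q IHq] /=; rewrite ?addn0 // IHq addSnnS. Qed.

Lemma split_end_admissible F (q : split_seq F) : admissible F -> admissible (split_end q).
Proof. by elim: q => [//|G i delta i2 good q IHq] _; apply: IHq; case: good. Qed.

Lemma all_one_ncoord F : admissible F -> (forall j, multiplicity F j = 1%N) <-> ncoord F = d.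
Proof.
move=> aF; have := sum_mult (adm_fact aF); split=> [one|nd j].
  by rewrite [RHS](sum_mult (adm_fact aF)) (eq_bigr (fun _ => 1%N)) // sum1_card card_ord.
have pos := mult_gt0 (adm_fact aF); apply/eqP; rewrite eqn_leq pos andbT leqNgt; apply/negP=> j2.
suff : (ncoord F < d)%N by rewrite nd ltnn.
rewrite [X in (_ < X)%N](sum_mult (adm_fact aF)) -[X in (X < _)%N]card_ord -sum1_card.
rewrite (bigD1 j) //= [X in (_ < X)%N](bigD1 j) //= -addSn leq_add //.
by apply: leq_sum => k _.
Qed.

(** Induction on d minus the number of coordinates, which drops at each split. *)
Lemma split_seq_complete F : (3 <= m)%N -> ~~ odd m -> admissible F ->
  exists q : split_seq F, forall j, multiplicity (split_end q) j = 1%N.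
Proof.
move=> m3 em; have [k] := ubnP (d - ncoord F); elim: k F => // k IHk F ltk aF.
have [/forallP one|] := boolP [forall j, multiplicity F j == 1%N].
  by exists (SplitStop F) => j; apply/eqP.
rewrite negb_forall => /existsP[j j1]; have j2 : (2 <= multiplicity F j)%N.
  by rewrite ltn_neqAle eq_sym j1 (mult_gt0 (adm_fact aF)).
have [delta good] := good_split_exists m3 em aF j2.
have aF' := gs_admissible good; have := ncoord_le aF'.
have [|q qP] := IHk _ _ aF'; last by exists (SplitStep j2 good q).
by have := ncoord_le aF' => /=; move: ltk; clear; lia.
Qed.

Lemma transport_seq_hamilton F (q : split_seq F) sigma (S' : 'I_d -> {perm torus m (ncoord F)}) :
    recolouring sigma S' -> (forall c, #|porbits (S' c)| = 1%N) ->
  exists2 S'' : 'I_d -> {perm torus m (ncoord (split_end q))},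
    recolouring (transport_seq q sigma) S'' & forall c, #|porbits (S'' c)| = 1%N.
Proof.
elim: q sigma S' => [G|G i delta i2 good q IHq] sigma S' rec ham; first by exists S'.
have [S1 rec1 card1] := gs_transport good rec.
by apply: IHq rec1 _ => c; rewrite card1.
Qed.

End Sequences.
Local Close Scope ring_scope.

Theorem theorem5p14 (m d : nat) (m_ge4 : 4 <= m) (m_even : ~~ odd m)
    (F : marked m d) (F_adm : admissible F) :
  (forall i : 'I_(ncoord F), 2 <= multiplicity F i ->
     exists delta : 'I_d -> torus m (ncoord F) -> bool, good_split i delta) /\
  (exists q : split_seq F, forall j, multiplicity (split_end q) j = 1) /\
  (forall q : split_seq F,
     (forall j, multiplicity (split_end q) j = 1) <-> split_size q = d - ncoord F) /\
  (forall q : split_seq F, split_size q = d - ncoord F ->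
   forall (sigma : torus m (ncoord F) -> {perm 'I_d})
          (S' : 'I_d -> {perm (torus m (ncoord F))}),
     recolouring sigma S' -> (forall c, #|porbits (S' c)| = 1) ->
     exists2 S'' : 'I_d -> {perm (torus m (ncoord (split_end q)))},
       recolouring (transport_seq q sigma) S'' &
       forall c, #|porbits (S'' c)| = 1).
Proof.
have m3 : 3 <= m := ltnW m_ge4; split; last split; last split.
- by move=> i; apply: good_split_exists.
- exact: split_seq_complete.
- move=> q; rewrite (all_one_ncoord (split_end_admissible q F_adm)) ncoord_split_end.
  by have := ncoord_le F_adm; split; clear -H; lia.
by move=> q _ sigma S'; apply: transport_seq_hamilton.
Qed.
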